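(* For every integer $n\ge5$, the graph $\Gamma(n,\{1,n-2\})$ has independence number $\binom n3+2$, and every independent set of $\Gamma(n,\{1,n-2\})$ of cardinality $\binom n3+2$ is equivalent to $\mathcal F_{n-5}(n,1,n-2)$, to $\mathcal F_{n-4}(n,1,n-2)$, or to $\bar{\mathcal F}_{n-3}(n,1,n-2)$.
   Context: $[n]=\{1,\dots,n\}$, $[0]=\emptyset$. Subsets $X,Y$ of $[n]$ are in general position if $X\cup Y=[n]$ or $X\cap Y=\emptyset$. For $a<b$, the vertices of $\Gamma(n,\{a,b\})$ are the pairs $(A,B)$ with $A\subseteq B\subseteq[n]$, $|A|=a$, $|B|=b$, and $(A,B)$, $(A',B')$ are adjacent iff each of $A,B$ is in general position with each of $A',B'$. For $a<\frac n2<b$, $a+b<n$ and integer $0\le i\le 2b-n+1$, $\mathcal F_i(n,a,b)$ is the set of vertices $(A,B)$ with (I) $[i]\subseteq B\subseteq[n-1]$ or (II) $\min A\le i$ and $[\min A]\subseteq B$; for $i=2b-n+1$, $\bar{\mathcal F}_i(n,a,b)$ is the set of vertices with $[i]\subseteq B$ or (II). Two independent sets are equivalent if they lie in the same orbit of the automorphism group of the graph. *)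

(* Defs.v *)
From HB Require Import structures.
From mathcomp Require Import all_boot all_fingroup.

Set Implicit Arguments.
Unset Strict Implicit.
Unset Printing Implicit Defensive.

Section Graph.
Variables (V : finType) (e : rel V).

Definition independent (S : {set V}) : bool :=
  [forall x in S, forall y in S, ~~ e x y].

Definition independence_number : nat := \max_(S : {set V} | independent S) #|S|.

Definition graph_aut : {set {perm V}} :=
  [set s : {perm V} | [forall x, forall y, e (s x) (s y) == e x y]].

Lemma graph_aut_group_set : group_set graph_aut.
Proof.
apply/group_setP; split=> [|s t].
  by rewrite inE; apply/forallP=> x; apply/forallP=> y; rewrite !perm1.
rewrite !inE => /'forall_'forall_eqP es /'forall_'forall_eqP et.
by apply/'forall_'forall_eqP=> x y; rewrite !permM et es.
Qed.

Canonical graph_aut_group := Group graph_aut_group_set.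

(* 'P^* is the action of permutations of V on sets of vertices. *)
Definition equivalent (S T : {set V}) : bool := T \in orbit 'P^* graph_aut S.

End Graph.

(* The ground set {1, ..., n} is represented by 'I_n, the ordinal x standing
   for the integer x.+1. *)

Definition general_position (n : nat) (X Y : {set 'I_n}) : bool :=
  (X :|: Y == [set: 'I_n]) || (X :&: Y == set0).

Record flag (n a b : nat) := Flag {
  flag_pair :> {set 'I_n} * {set 'I_n};
  flagP : [&& flag_pair.1 \subset flag_pair.2, #|flag_pair.1| == a
            & #|flag_pair.2| == b]
}.

HB.instance Definition _ n a b := [isSub for @flag_pair n a b].
HB.instance Definition _ n a b := [Finite of flag n a b by <:].

Section Gamma.
Variables n a b : nat.

Definition Gamma_adj : rel (flag n a b) := fun f g =>
  [&& general_position f.1 g.1, general_position f.1 g.2,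
      general_position f.2 g.1 & general_position f.2 g.2].

(* {1, ..., i}, for i <= n *)
Definition initial (i : nat) : {set 'I_n} := [set x : 'I_n | x < i].

Definition is_min (A : {set 'I_n}) (m : 'I_n) : bool :=
  (m \in A) && [forall x in A, m <= x].

(* Condition (II): the minimum of A is the integer m.+1, so min A <= i reads
   m.+1 <= i and the set {1, ..., min A} is initial m.+1. *)
Definition cond_II (i : nat) (f : flag n a b) : bool :=
  [exists m : 'I_n,
    [&& is_min f.1 m, m.+1 <= i & initial m.+1 \subset f.2]].

Definition F_set (i : nat) : {set flag n a b} :=
  [set f : flag n a b |
    ((initial i \subset f.2) && (f.2 \subset initial n.-1)) || cond_II i f].

(* Only meant for i = 2b - n + 1. *)
Definition Fbar_set (i : nat) : {set flag n a b} :=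
  [set f : flag n a b | (initial i \subset f.2) || cond_II i f].

End Gamma.

(* Main.v *)
Require Import Defs.
From mathcomp Require Import all_boot all_fingroup.
From mathcomp Require Import zify.

Set Implicit Arguments.
Unset Strict Implicit.
Unset Printing Implicit Defensive.

(* A flag ({x}, [n] \ {y, z}) is a triple {x, y, z} pointed at x, and two of
   them are adjacent iff the triples meet exactly in the two distinguished
   points, these being distinct.  So for a pair {x, y}, either one of the two
   points is never chosen in a triple through {x, y}, or there is a single z
   such that both are chosen, and then only in {x, y, z}; call x and y tied in
   that case.

   In a maximum independent set, letting a point x win over all points that do
   not strictly beat it cannot enlarge the set.  This bounds the local data of
   a tied point: 2 d + k <= 5 for k ties and d points strictly below it.
   If some point v is neither tied nor the third point of a tied pair, letting v
   win everywhere shows that v carries exactly (n-1)(n-2)/2 pointed triples, and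
   induction applies to the remaining n-1 points.  Otherwise every untied point
   lies strictly below two tied ones, and counting leaves only n <= 5, where all
   the ties have one and the same third point c, the centre of a star.
   Hence an extremal set is obtained by successively removing points that win
   all their triples, until a full triple or a star on 4 or 5 points is left. *)

(** * Pointed triples *)

Section Systems.
Variable T : finType.
Implicit Types (V A : {set T}) (S : {set T * T * T}) (x y z t u v w : T).

(* [(x, y, z)] stands for the triple {x, y, z} pointed at [x]; closure under
   swapping [y] and [z] makes every pointed triple count twice. *)
Definition valid V S : bool :=
  [forall x, forall y, forall z, ((x, y, z) \in S) ==>
    [&& [&& x \in V, y \in V & z \in V], [&& x != y, x != z & y != z],
        (x, z, y) \in S & [forall w, ((y, x, w) \in S) ==> (w == z)]]].

Lemma validP V S :
  reflect [/\ forall x y z, (x, y, z) \in S -> [/\ x \in V, y \in V & z \in V],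
              forall x y z, (x, y, z) \in S -> [/\ x != y, x != z & y != z],
              forall x y z, (x, y, z) \in S -> (x, z, y) \in S
            & forall x y z w, (x, y, z) \in S -> (y, x, w) \in S -> w = z]
          (valid V S).
Proof.
apply: (iffP idP) => [vS | [inV neq sym ind]].
  have P x y z : (x, y, z) \in S -> _ :=
    implyP (forallP (forallP (forallP vS x) y) z).
  split=> [x y z /P/and4P[/and3P[]] | x y z /P/and4P[_ /and3P[]]
          | x y z /P/and4P[] | x y z w /P/and4P[_ _ _ /forallP/(_ w)/implyP H]].
  - by split.
  - by split.
  - by [].
  - by move/H/eqP.
apply/forallP=> x; apply/forallP=> y; apply/forallP=> z; apply/implyP=> Sxyz.
have [-> -> ->] := inV _ _ _ Sxyz; have [-> -> ->] := neq _ _ _ Sxyz.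
rewrite (sym _ _ _ Sxyz) /=; apply/forallP=> w; apply/implyP=> Syxw.
by apply/eqP/(ind _ _ _ _ Sxyz).
Qed.

Definition maximum V S := forall S', valid V S' -> #|S'| <= #|S|.

Definition offdiag A : {set T * T} :=
  [set p | [&& p.1 \in A, p.2 \in A & p.1 != p.2]].

Lemma in_offdiag A p :
  (p \in offdiag A) = [&& p.1 \in A, p.2 \in A & p.1 != p.2].
Proof. exact: in_set. Qed.

Lemma card_offdiag A : #|offdiag A| = #|A| * (#|A| - 1).
Proof.
have diag : #|[set (x, x) | x in A]| = #|A| by apply: card_imset => x y [].
have sub : [set (x, x) | x in A] \subset setX A A.
  by apply/subsetP=> p /imsetP[x xA ->]; rewrite inE /= xA.
have -> : offdiag A = setX A A :\: [set (x, x) | x in A].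
  apply/setP=> [[x y]]; rewrite in_setD in_setX inE /= andbA andbC.
  have [xA|] := boolP (x \in A); last by rewrite !andbF.
  congr (~~ _ && _); apply/eqP/imsetP=> [<- | [z _ [-> ->]] //].
  by exists x.
by rewrite cardsD (setIidPr sub) cardsX diag; nia.
Qed.

Definition link S x : {set T * T} := [set p | (x, p.1, p.2) \in S].

Lemma card_link S : #|S| = \sum_x #|link S x|.
Proof.
rewrite -sum1_card (partition_big (fun p : T * T * T => p.1.1) predT) //=.
apply: eq_bigr => x _; rewrite sum1dep_card.
rewrite -(card_imset (f := fun p => (x, p.1, p.2)) (link S x));
  last by move=> [a b] [c d] [-> ->].
apply: eq_card => [[[a b] c]]; rewrite !inE /=;
  apply/andP/imsetP => [[Sabc /eqP <-]|[[p q]]].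
  by exists (b, c); rewrite ?inE.
by rewrite inE /= => Sxpq [-> -> ->].
Qed.

Definition beats S x y := [exists z, (x, y, z) \in S].
Definition ties S x := [set y | beats S x y && beats S y x].
(* The points that do not strictly beat [x]: tied points, and points such that
   neither beats the other, are lower than each other. *)
Definition lower V S x := [set y in V | (y != x) && (beats S x y || ~~ beats S y x)].
Definition strict_lower V S x := lower V S x :\: ties S x.

Lemma beatsI S x y z : (x, y, z) \in S -> beats S x y.
Proof. by move=> Sxyz; apply/existsP; exists z. Qed.

Lemma in_strict_lower V S x y :
  (y \in strict_lower V S x) = (y \notin ties S x) && (y \in lower V S x).
Proof. exact: in_setD. Qed.

Lemma tiesC S x y : (y \in ties S x) = (x \in ties S y).
Proof. by rewrite !inE andbC. Qed.

Section Valid.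
Variables (V : {set T}) (S : {set T * T * T}).
Hypothesis vS : valid V S.

Lemma vin x y z : (x, y, z) \in S -> [/\ x \in V, y \in V & z \in V].
Proof. by case/validP: vS => H _ _ _; apply: H. Qed.
Lemma vneq x y z : (x, y, z) \in S -> [/\ x != y, x != z & y != z].
Proof. by case/validP: vS => _ H _ _; apply: H. Qed.
Lemma vsym x y z : (x, y, z) \in S -> (x, z, y) \in S.
Proof. by case/validP: vS => _ _ H _; apply: H. Qed.
Lemma vind x y z w : (x, y, z) \in S -> (y, x, w) \in S -> w = z.
Proof. by case/validP: vS => _ _ _; apply. Qed.

Lemma beats_in x y : beats S x y -> [/\ x \in V, y \in V & y != x].
Proof.
case/existsP=> z Sxyz; have [xV yV _] := vin Sxyz; have [xy _ _] := vneq Sxyz.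
by rewrite eq_sym xy.
Qed.

Lemma beats_lower x y : beats S x y -> y \in lower V S x.
Proof. by move=> o; have [_ yV yx] := beats_in o; rewrite inE yV yx o. Qed.

Lemma ties_lower x : ties S x \subset lower V S x.
Proof. by apply/subsetP=> y; rewrite inE => /andP[/beats_lower]. Qed.

(** A triple pointed at [y] through [x] exists, and by validity every triple pointed at [x] through
    [y] has the same third point as it. *)
Lemma tie_uniq x y z w : y \in ties S x -> (x, y, z) \in S -> (x, y, w) \in S -> z = w.
Proof.
rewrite inE => /andP[_ /existsP[u Syxu]] Sz Sw.
by rewrite -(vind Sz Syxu) -(vind Sw Syxu).
Qed.

Lemma tie_witness x y : y \in ties S x -> exists2 z, (x, y, z) \in S & (y, x, z) \in S.
Proof.
rewrite inE => /andP[/existsP[z Sz] /existsP[w Sw]]; exists z => //.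
by rewrite -(vind Sz Sw).
Qed.

Lemma card_lower x : #|lower V S x| = #|strict_lower V S x| + #|ties S x|.
Proof. by rewrite -(cardsID (ties S x)) (setIidPr (ties_lower x)) addnC. Qed.

Lemma link_tie_fst x : #|[set p in link S x | p.1 \in ties S x]| <= #|ties S x|.
Proof.
rewrite -(card_in_imset (f := fst)).
  by apply/subset_leq_card/subsetP=> y /imsetP[[a b]]; rewrite !inE /= => /andP[_ ?] ->.
move=> [a b] [c d]; rewrite !inE /= => /andP[Sa ta] /andP[Sc _] eac; subst c.
by congr pair; apply: (@tie_uniq x a); rewrite ?inE.
Qed.

Lemma link_tie_snd x : #|[set p in link S x | p.2 \in ties S x]| <= #|ties S x|.
Proof.
rewrite -(card_in_imset (f := snd)).
  by apply/subset_leq_card/subsetP=> y /imsetP[[a b]]; rewrite !inE /= => /andP[_ ?] ->.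
move=> [a b] [c d]; rewrite !inE /= => /andP[Sa ta] /andP[Sc _] eac; subst d.
by congr pair; apply: (@tie_uniq x b); rewrite ?inE //; apply: vsym.
Qed.

Lemma link_strict_lower x p : p \in link S x ->
  [|| (p \in offdiag (strict_lower V S x)), p.1 \in ties S x | p.2 \in ties S x].
Proof.
case: p => y z; rewrite inE /= => Sx; have [xy xz yz] := vneq Sx.
have yR := beats_lower (beatsI Sx); have zR := beats_lower (beatsI (vsym Sx)).
rewrite in_offdiag /= !in_strict_lower yR zR yz.
by case: (y \in _); case: (z \in _).
Qed.

(** Both coordinates of a pair in the link are lower than [x]. Either both are strictly lower, or
    one is tied, and by [tie_uniq] a tied point occurs at most once in each coordinate. *)
Lemma card_link_le x :
  #|link S x| <= #|strict_lower V S x| * (#|strict_lower V S x| - 1) + 2 * #|ties S x|.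
Proof.
set A := [set p in link S x | p.1 \in ties S x].
set B := [set p in link S x | p.2 \in ties S x].
have sub : link S x \subset offdiag (strict_lower V S x) :|: (A :|: B).
  apply/subsetP=> p xp; rewrite !in_setU.
  have [-> //|pA|pB] := or3P (link_strict_lower xp).
    by rewrite [p \in A]in_set xp pA orbT.
  by rewrite [p \in B]in_set xp pB !orbT.
apply: leq_trans (subset_leq_card sub) _; rewrite -card_offdiag.
have := (leq_card_setU (offdiag (strict_lower V S x)) (A :|: B)).1.
have := (leq_card_setU A B).1.
have : #|A| <= _ := link_tie_fst x; have : #|B| <= _ := link_tie_snd x; lia.
Qed.

(** Without strictly lower points every first coordinate is tied, so counting first coordinates
    suffices; this halves the bound of [card_link_le]. *)
Lemma card_link_le0 x : #|strict_lower V S x| = 0 -> #|link S x| <= #|ties S x|.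
Proof.
move/eqP; rewrite cards_eq0 => /eqP D0; apply: leq_trans (link_tie_fst x).
apply/subset_leq_card/subsetP=> p Lp; rewrite in_set Lp /=.
have : beats S x p.1 by move: Lp; rewrite inE => /beatsI.
move/beats_lower; apply: contraLR => nt.
by have := in_set0 p.1; rewrite -D0 in_strict_lower nt /= => ->.
Qed.

End Valid.
End Systems.

(** * Letting a point win over its lower points *)

Section Flip.
Variable T : finType.
Implicit Types (V A : {set T}) (S : {set T * T * T}) (x y z t u v w : T).

(* What is left of [S] when [x] is made to win over all of [lower V S x]. *)
Definition flip_rest V S x := [set p in S | (p.1.1 != x)
  && ~~ ((p.1.1 \in lower V S x) && ((p.1.2 == x) || (p.2 == x)))].
Definition fan x A : {set T * T * T} := [set (x, p.1, p.2) | p in offdiag A].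

Lemma in_fan x A y z t :
  ((y, z, t) \in fan x A) = [&& y == x, z \in A, t \in A & z != t].
Proof.
apply/imsetP/and4P=> [[[p q]]|[/eqP-> zA tA zt]].
  by rewrite in_offdiag /= => /and3P[? ? ?] [-> -> ->].
by exists (z, t); rewrite // in_offdiag /= zA tA.
Qed.

Lemma card_fan x A : #|fan x A| = #|A| * (#|A| - 1).
Proof. by rewrite card_imset ?card_offdiag // => [[a b] [c d] [-> ->]]. Qed.

Lemma in_flip_rest V S x y z t : ((y, z, t) \in flip_rest V S x) =
  [&& (y, z, t) \in S, y != x & ~~ ((y \in lower V S x) && ((z == x) || (t == x)))].
Proof. exact: in_set. Qed.

(** The new triples at [x] only involve points of [lower V S x], and these keep no triple through
    [x]; so a clash could only occur inside [S]. *)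
Lemma valid_flip V S x : valid V S -> x \in V ->
  valid V (fan x (lower V S x) :|: flip_rest V S x).
Proof.
move=> vS xV; set R := lower V S x.
have RP y : y \in R -> y \in V /\ y != x by rewrite inE => /and3P[].
apply/validP; split=> [a b c|a b c|a b c|a b c d];
  rewrite !in_setU !in_fan !in_flip_rest.
- case/orP=> [/and4P[/eqP-> /RP[? _] /RP[? _] _]|/andP[]]; first by split.
  by move/(vin vS).
- case/orP=> [/and4P[/eqP-> /RP[_ bx] /RP[_ cx] bc]|/andP[]].
    by rewrite ![x == _]eq_sym.
  by move/(vneq vS).
- case/orP=> [/and4P[-> -> -> bc]|/and3P[/(vsym vS)-> -> nb]].
    by rewrite eq_sym bc.
  by rewrite [(c == x) || _]orbC nb orbT.
case/orP=> [/and4P[/eqP-> bR cR bc]|/and3P[Sabc ax nb]].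
  have [_ bx] := RP _ bR.
  by rewrite (negbTE bx) -/R bR eqxx !andbF.
case/orP=> [/and4P[/eqP bx aR _ _]|/andP[Sbad _]];
  last exact: vind vS _ _ _ _ Sabc Sbad.
by rewrite bx -/R aR eqxx in nb.
Qed.

(** With r lower points the fan has r(r-1) elements. What is lost is the link of [x] and the triples
    through [x] pointed at a lower point; such a point beats [x], hence is tied to it, and loses a
    single pointed triple, in two orders. *)
Lemma flip_le V S x : valid V S -> maximum V S -> x \in V ->
  #|lower V S x| * (#|lower V S x| - 1) <= #|link S x| + 2 * #|ties S x|.
Proof.
move=> vS maxS xV; have := maxS _ (valid_flip vS xV).
set R := lower V S x.
have dis : [disjoint fan x R & flip_rest V S x].
  apply/pred0P=> [[[a b] c]] /=; rewrite in_fan in_flip_rest.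
  by case: (a == x); rewrite ?andbF.
have -> : #|fan x R :|: flip_rest V S x| = #|fan x R| + #|flip_rest V S x|.
  by apply/eqP; rewrite (leq_card_setU _ _).2.
rewrite card_fan.
pose X : {set T * T * T} := [set (x, p.1, p.2) | p in link S x].
set A := [set p in S | (p.1.1 \in R) && (p.1.2 == x)].
set B := [set p in S | (p.1.1 \in R) && (p.2 == x)].
have cX : #|X| = #|link S x| by apply: card_imset => [[a b] [c d] [-> ->]].
have tie a b : a \in R -> (a, x, b) \in S -> a \in ties S x.
  move=> aR Sa; have oa := beatsI Sa; move: aR.
  by rewrite !inE oa orbF => /and3P[_ _ ->].
have cA : #|A| <= #|ties S x|.
  rewrite -(card_in_imset (f := fun p => p.1.1)).
    apply/subset_leq_card/subsetP=> a /imsetP[[[b c] d]].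
    by rewrite inE /= => /and3P[Sb bR /eqP cx] ->; rewrite cx in Sb;
      exact: (tie _ _ bR Sb).
  move=> [[a b] c] [[d e] f]; rewrite ![_ \in A]in_set /= => /and3P[Sa aR /eqP bx].
  move=> /and3P[Sd dR /eqP ex] ead.
  move: ead => /= ead; rewrite -ead ex bx in Sa Sd *.
  have xa : x \in ties S a by rewrite tiesC; exact: (tie _ _ aR Sa).
  by rewrite (tie_uniq vS xa Sa Sd).
have cB : #|B| <= #|ties S x|.
  rewrite -(card_in_imset (f := fun p => p.1.1)).
    apply/subset_leq_card/subsetP=> a /imsetP[[[b c] d]].
    by rewrite inE /= => /and3P[/(vsym vS) Sb bR /eqP cx] ->; rewrite cx in Sb;
      exact: (tie _ _ bR Sb).
  move=> [[a b] c] [[d e] f]; rewrite ![_ \in B]in_set /= => /and3P[/(vsym vS) Sa aR /eqP bx].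
  move=> /and3P[/(vsym vS) Sd dR /eqP ex] ead.
  move: ead => /= ead; rewrite -ead ex bx in Sa Sd *.
  have xa : x \in ties S a by rewrite tiesC; exact: (tie _ _ aR Sa).
  by rewrite (tie_uniq vS xa Sa Sd).
have sub : S \subset (X :|: flip_rest V S x) :|: (A :|: B).
  apply/subsetP=> [[[a b] c]] Sabc; rewrite !in_setU in_flip_rest Sabc /=.
  rewrite [_ \in A]in_set [_ \in B]in_set Sabc /= -/R.
  have [ax|ax] := eqVneq a x.
    by rewrite (_ : _ \in X) //; apply/imsetP; exists (b, c); rewrite ?ax ?inE /= -?ax.
  by case: (a \in R); rewrite ?orbT //=; case: (b == x); case: (c == x); rewrite ?orbT.
have := subset_leq_card sub.
have := (leq_card_setU (X :|: flip_rest V S x) (A :|: B)).1.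
have := (leq_card_setU X (flip_rest V S x)).1; have := (leq_card_setU A B).1.
lia.
Qed.

(** With d strictly lower and k tied points, [flip_le] and [card_link_le] give (d+k)(d+k-1) <=
    d(d-1) + 4k; cancelling k > 0 leaves 2d + k - 1 <= 4. *)
Lemma tied_bounds V S x : valid V S -> maximum V S -> 0 < #|ties S x| ->
  2 * #|strict_lower V S x| + #|ties S x| <= 5.
Proof.
move=> vS maxS k0.
have xV : x \in V.
  have [y] := card_gt0P k0; rewrite inE => /andP[oxy _].
  by have [] := beats_in vS oxy.
have := flip_le vS maxS xV; have := card_link_le vS x.
rewrite (card_lower vS) => Hl Hf; rewrite leqNgt; apply/negP=> H6.
nia.
Qed.
End Flip.

(** * Removing a clean point *)

Section Delete.
Variable T : finType.
Implicit Types (V : {set T}) (S : {set T * T * T}) (x y z t u v w : T).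

Definition delete S v : {set T * T * T} :=
  [set p in S | [&& p.1.1 != v, p.1.2 != v & p.2 != v]].

Lemma in_delete S v x y z : ((x, y, z) \in delete S v) =
  [&& (x, y, z) \in S, x != v, y != v & z != v].
Proof. exact: in_set. Qed.

Lemma valid_delete V S v : valid V S -> valid (V :\ v) (delete S v).
Proof.
move=> vS; apply/validP; split=> [a b c|a b c|a b c|a b c d]; rewrite !in_delete.
- by case/and4P=> /(vin vS)[aV bV cV] av bv cv; rewrite !inE av bv cv.
- by case/and4P=> /(vneq vS).
- by case/and4P=> /(vsym vS)-> -> -> ->.
by case/and4P=> Sabc _ _ _ /and4P[Sbad _ _ _]; apply: (vind vS Sabc).
Qed.

Lemma valid_fan V S v : v \in V -> valid (V :\ v) S ->
  valid V (fan v (V :\ v) :|: S).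
Proof.
move=> vV vS.
have out a b c : (a, b, c) \in S ->
    [/\ a != v, b != v & c != v] /\ [/\ a \in V, b \in V & c \in V].
  by move/(vin vS); rewrite !inE => [[/andP[-> ->] /andP[-> ->] /andP[-> ->]]].
apply/validP; split=> [a b c|a b c|a b c|a b c d]; rewrite !in_setU !in_fan !in_setD1.
- by case/orP=> [/and4P[/eqP-> /andP[_ ->] /andP[_ ->] _]|/out[]].
- case/orP=> [/and4P[/eqP-> /andP[bv _] /andP[cv _] bc]|/(vneq vS)//].
  by rewrite ![v == _]eq_sym.
- case/orP=> [/and4P[-> -> -> bc]|/(vsym vS)->]; last by rewrite orbT.
  by rewrite eq_sym bc.
case/orP=> [/and4P[/eqP-> /andP[bv _] /andP[cv _] bc]|Sabc].
  by rewrite (negbTE bv) => /out[[_ /eqP]].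
case/orP=> [/and4P[/eqP bv _ _ _]|]; last exact: vind vS _ _ _ _ Sabc.
by have [[_ /eqP]] := out _ _ _ Sabc.
Qed.

Lemma card_fanU V S v : v \in V -> valid (V :\ v) S ->
  #|fan v (V :\ v) :|: S| = (#|V| - 1) * (#|V| - 2) + #|S|.
Proof.
move=> vV vS; have -> : #|fan v (V :\ v) :|: S| = #|fan v (V :\ v)| + #|S|.
  apply/eqP; rewrite (leq_card_setU _ _).2; apply/pred0P=> [[[a b] c]] /=.
  rewrite in_fan; apply/negP=> /andP[/andP[/eqP-> _] /(vin vS)[]].
  by rewrite !inE eqxx.
rewrite card_fan [#|V|](cardsD1 v) vV; congr (_ * _ + _); lia.
Qed.

Lemma maximum_delete V S v : v \in V -> valid V S -> maximum V S ->
  (#|V| - 1) * (#|V| - 2) + #|delete S v| = #|S| -> maximum (V :\ v) (delete S v).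
Proof.
move=> vV vS maxS cS S' vS'; have := maxS _ (valid_fan vV vS').
by rewrite card_fanU //; lia.
Qed.

(* [v] is never tied, nor is it the third point of a tied pair. *)
Definition clean S v :=
  (ties S v == set0) &&
  [forall y, forall z, ((y, z, v) \in S) ==> ((z, y, v) \notin S)].

(** A clean [v] lies in at most one pointed triple with each pair of other points, so at most
    (n-1)(n-2) ordered triples contain [v]. Letting [v] win everywhere attains this, so maximality
    forces equality, and every pair is covered. *)
Lemma clean_delete V S v : v \in V -> valid V S -> maximum V S -> clean S v ->
  (#|V| - 1) * (#|V| - 2) + #|delete S v| = #|S| /\
  forall y z, y \in V :\ v -> z \in V :\ v -> y != z ->
    [|| (v, y, z) \in S, (y, v, z) \in S | (z, v, y) \in S].
Proof.
move=> vV vS maxS /andP[/eqP ties0 /'forall_'forall_implyP nwit].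
have := maxS _ (valid_fan vV (valid_delete v vS)).
rewrite card_fanU ?valid_delete //.
have tie0 y z w : (v, y, z) \in S -> (y, v, w) \in S -> False.
  move=> Sv Sy; have := in_set0 y; rewrite -ties0 inE.
  by rewrite (beatsI Sv) (beatsI Sy).
(* [g] keeps the two points other than [v], ordered so that the two orders of a pointed triple go to
   the two orders of the pair. *)
pose g (p : T * T * T) := if p.1.1 == v then (p.1.2, p.2)
  else if p.1.2 == v then (p.1.1, p.2) else (p.1.2, p.1.1).
have dS : delete S v \subset S by apply/subsetP=> p; rewrite inE => /andP[].
have cS := cardsID (delete S v) S; rewrite (setIidPr dS) in cS.
set X := S :\: delete S v in cS *.
have inX a b c : (a, b, c) \in X -> (a, b, c) \in S /\ [|| a == v, b == v | c == v].
  by rewrite in_setD in_delete; case: (_ \in S);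
    rewrite ?andbF //= andbT !negb_and !negbK.
have gP p : p \in X -> exists y z, [/\ g p = (y, z), (y, z) \in offdiag (V :\ v),
    p \in S & [\/ p = (v, y, z), p = (y, v, z) | p = (z, y, v)]].
  case: p => [[a b] c] /inX[Sabc av].
  have [ab ac bc] := vneq vS Sabc; have [aV bV cV] := vin vS Sabc.
  rewrite /g /=; case: eqVneq Sabc av ab ac => [-> Sabc _ vb vc | an Sabc /= av ab ac].
    exists b, c; split=> //; last by constructor 1.
    by rewrite in_offdiag !in_setD1 /= bV cV bc !andbT ![_ == v]eq_sym vb.
  case: eqVneq Sabc av bc => [-> Sabc _ vc | bn Sabc /= /eqP cv bc];
    last rewrite cv in Sabc *.
    exists a, c; split=> //; last by constructor 2.
    by rewrite in_offdiag !in_setD1 /= aV cV ac an !andbT eq_sym.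
  exists b, a; split=> //; last by constructor 3.
  by rewrite in_offdiag !in_setD1 /= aV bV an bn eq_sym.
have ginj : {in X &, injective g}.
  move=> p q /gP[y [z [-> _ Sp defp]]] /gP[y' [z' [-> _ Sq defq]]] [ey ez].
  subst y' z'; move: Sp Sq.
  case: defp defq => -> [] -> // S1 S2; exfalso.
  - exact: tie0 S1 S2.
  - exact: tie0 (vsym vS S1) (vsym vS S2).
  - exact: tie0 S2 S1.
  - by have := nwit _ _ (vsym vS S1); rewrite S2.
  - exact: tie0 (vsym vS S2) (vsym vS S1).
  - by have := nwit _ _ S1; rewrite (vsym vS S2).
have gsub : g @: X \subset offdiag (V :\ v).
  by apply/subsetP=> q /imsetP[p /gP[y [z [-> yz _ _]]] ->].
have cV : #|offdiag (V :\ v)| = (#|V| - 1) * (#|V| - 2).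
  by rewrite card_offdiag [#|V|](cardsD1 v) vV; congr (_ * _); lia.
have leX : #|X| <= (#|V| - 1) * (#|V| - 2).
  by rewrite -cV -(card_in_imset ginj) subset_leq_card.
move=> leS.
have eX : #|X| = (#|V| - 1) * (#|V| - 2) by lia.
split=> [|y z yV zV yz]; first by lia.
have : (y, z) \in g @: X.
  have /eqP-> : g @: X == offdiag (V :\ v).
    by rewrite eqEcard gsub cV card_in_imset // eX leqnn.
  by rewrite in_offdiag /= yV zV.
case/imsetP=> p /gP[y' [z' [-> _ Sp defp]]] [-> ->].
by case: defp Sp => -> S0; rewrite ?S0 ?(vsym vS S0) ?orbT.
Qed.
End Delete.

(** * Winning points and stars *)

Section Apex.
Variable T : finType.
Implicit Types (V M : {set T}) (S : {set T * T * T}) (x y z t u v w c : T).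

Definition apex V S t := t \in V /\
  forall y z, y \in V :\ t -> z \in V :\ t -> y != z -> (t, y, z) \in S.
(** All points but [c] are then pairwise tied, always with third point [c]. *)
Definition star V S c := c \in V /\
  forall y z, y \in V :\ c -> z \in V :\ c -> y != z -> (y, z, c) \in S.

Lemma fresh V (s : seq T) : size s < #|V| -> exists2 x, x \in V & x \notin s.
Proof.
move=> sV; have : 0 < #|V :\: [set x in s]|.
  rewrite cardsD subn_gt0; apply: leq_ltn_trans sV.
  apply: leq_trans (subset_leq_card (subsetIr _ _)) _.
  by rewrite cardsE card_size.
by case/card_gt0P=> x; rewrite !inE => /andP[xs xV]; exists x.
Qed.

Section Clean.
Variables (V : {set T}) (S : {set T * T * T}) (v : T).
Hypotheses (vS : valid V S) (vV : v \in V) (cl : clean S v) (V4 : 3 < #|V|).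
Hypothesis cover : forall y z, y \in V :\ v -> z \in V :\ v -> y != z ->
  [|| (v, y, z) \in S, (y, v, z) \in S | (z, v, y) \in S].

Lemma clean_tie y : beats S v y -> ~~ beats S y v.
Proof.
move=> o; apply/negP=> o'; have := in_set0 y; case/andP: cl => /eqP<- _.
by rewrite inE o o'.
Qed.

Lemma apex_clean : (forall u, u \in V :\ v -> ~~ beats S u v) -> apex V S v.
Proof.
move=> nov; split=> // y z yV zV yz.
have := cover yV zV yz; case/or3P=> // /beatsI; first by rewrite (negbTE (nov _ yV)).
by rewrite (negbTE (nov _ zV)).
Qed.

(** If [t] beats [v] then [t] remains an apex, otherwise [v] is one: in each case [cover] leaves a
    single point at which a triple {v, t, z} can be pointed. *)
Lemma apex_delete t : apex (V :\ v) (delete S v) t -> exists t', apex V S t'.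
Proof.
case=> tV apt.
have apt' y z : y \in V :\ v -> z \in V :\ v -> y != t -> z != t -> y != z ->
    (t, y, z) \in S.
  move=> yV zV yt zt yz; have := apt y z;
    rewrite ![_ \in _ :\ t]in_setD1 yt zt yV zV yz.
  by rewrite in_delete => /(_ isT isT isT)/and4P[].
(* [t] wins {t, u, z} for some z other than [v], so [u] cannot win {u, t, v}. *)
have nov u : u \in V :\ v -> u != t -> (u, t, v) \notin S.
  move=> uV ut; apply/negP=> Sutv.
  have [z zV] := @fresh V [:: v; t; u] V4; rewrite !inE !negb_or => /and3P[zv zt zu].
  have zV' : z \in V :\ v by rewrite in_setD1 zv.
  have Stu := apt' u z uV zV' ut zt _.
  by move: zv; rewrite -(vind vS (Stu _) Sutv) ?eqxx // eq_sym.
have [/existsP[w Stvw]|ntv] := boolP (beats S t v); last first.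
  exists v; apply: apex_clean => u uV.
  have [-> //|ut] := eqVneq u t; apply/negP=> ouv.
  case/or3P: (cover uV tV ut) => [/beatsI/clean_tie|/(vsym vS)|/beatsI].
  - by rewrite ouv.
  - by rewrite (negbTE (nov _ uV ut)).
  - by rewrite (negbTE ntv).
have tvz z : z \in V :\ v -> z != t -> (t, v, z) \in S.
  move=> zV zt; rewrite eq_sym in zt.
  case/or3P: (cover tV zV zt) => [/beatsI/clean_tie|//|/(vsym vS)].
    by rewrite (beatsI Stvw).
  by rewrite (negbTE (nov _ zV _)) // eq_sym.
exists t; split=> [|y z]; first by move: tV; rewrite in_setD1 => /andP[].
rewrite !in_setD1 => /andP[yt yV] /andP[zt zV] yz.
have [yv|yv] := eqVneq y v.
  by rewrite yv; apply: tvz; rewrite // in_setD1 -yv eq_sym yz.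
have [zv|zv] := eqVneq z v.
  by rewrite zv; apply: (vsym vS); apply: tvz; rewrite // in_setD1 -zv yz.
by apply: apt'; rewrite // in_setD1 ?yv ?zv.
Qed.

(** Two points other than [c] are tied with third point [c], so neither wins its triple with the
    other and [v]; by [cover], [v] wins it. *)
Lemma star_delete c : star (V :\ v) (delete S v) c -> apex V S v.
Proof.
case=> cV stc.
have cv : c != v by move: cV; rewrite in_setD1 => /andP[].
have st y z : y \in V :\ v -> z \in V :\ v -> y != c -> z != c -> y != z ->
    (y, z, c) \in S.
  move=> yV zV yc zc yz; have := stc y z;
    rewrite ![_ \in _ :\ c]in_setD1 yc zc yV zV yz.
  by rewrite in_delete => /(_ isT isT isT)/and4P[].
have other y : exists z, [/\ z \in V :\ v, z != c & z != y].
  have [z zV] := @fresh V [:: v; c; y] V4; rewrite !inE !negb_or => /and3P[zv zc zy].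
  by exists z; rewrite in_setD1 zv.
have nov u : u \in V :\ v -> u != c -> ~~ beats S u v.
  move=> uV uc; apply/negP=> ouv; have [z [zV zc zu]] := other u.
  have uz : u != z by rewrite eq_sym.
  case/or3P: (cover uV zV uz) => [/beatsI/clean_tie|/(vsym vS) S1|/(vsym vS) S1].
  - by rewrite ouv.
  - by move: cv; rewrite (vind vS S1 (st _ _ zV uV zc uc zu)) eqxx.
  - by move: cv; rewrite (vind vS S1 (st _ _ uV zV uc zc uz)) eqxx.
apply: apex_clean => u uV; have [->|/nov->//] := eqVneq u c.
(* If [c] beat [v], cleanness would leave {v, c, y} to be pointed at [c], against (y, c, z), or at
   [y], which does not beat [v]. *)
apply/negP=> ocv.
have [y [yV yc _]] := other v; have [z [zV zc zy]] := other y.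
have cy : c != y by rewrite eq_sym.
case/or3P: (cover cV yV cy) => [/beatsI/clean_tie|/(vsym vS) S1|/beatsI].
- by rewrite ocv.
- have S2 := st _ _ yV zV yc zc; rewrite eq_sym in S2.
  have := vind vS S1 (vsym vS (S2 zy)) => ezv.
  by move: zV; rewrite in_setD1 ezv eqxx.
- by rewrite (negbTE (nov _ yV yc)).
Qed.

End Clean.

Lemma link_offdiag V S x : valid V S -> link S x \subset offdiag (V :\ x).
Proof.
move=> vS; apply/subsetP=> [[y z]]; rewrite inE in_offdiag /= => Sx.
have [_ yV zV] := vin vS Sx; have [xy xz yz] := vneq vS Sx.
by rewrite !in_setD1 yV zV yz ![_ == x]eq_sym xy xz.
Qed.

Lemma link_out V S x : valid V S -> x \notin V -> #|link S x| = 0.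
Proof.
move=> vS xV; apply: eq_card0 => [[y z]]; rewrite inE /=.
by apply/negP=> /(vin vS)[]; rewrite (negbTE xV).
Qed.

Lemma card_link_sum V S M a b : valid V S -> M \subset V ->
  (forall x, x \in M -> #|link S x| <= a) ->
  (forall x, x \in V :\: M -> #|link S x| <= b) ->
  #|S| <= a * #|M| + b * (#|V| - #|M|).
Proof.
move=> vS MV Ma Mb; rewrite card_link (bigID (mem M)) /=; apply: leq_add.
  by rewrite mulnC -sum_nat_const leq_sum.
rewrite -{2}(setIidPr MV) -cardsD mulnC -sum_nat_const.
rewrite (bigID (mem V)) /= [X in _ + X]big1 ?addn0 => [|x /andP[_ /(link_out vS)//]].
by rewrite (eq_bigl (mem (V :\: M))) ?leq_sum // => x; rewrite !inE.
Qed.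

(** Each of the three links has size at most 2, so a total of 6 makes all of them full. *)
Lemma apex3 V S t : valid V S -> #|V| = 3 -> 6 <= #|S| -> t \in V -> apex V S t.
Proof.
move=> vS V3 S6 tV.
have cV x : x \in V -> #|offdiag (V :\ x)| = 2.
  by rewrite card_offdiag => xV; have := cardsD1 x V; rewrite xV V3; nia.
have l2 x : x \in V -> #|link S x| <= 2.
  by move=> xV; rewrite -(cV x xV) subset_leq_card // (link_offdiag x vS).
have lt : 2 <= #|link S t|.
  have := @card_link_sum V S [set t] #|link S t| 2 vS.
  rewrite sub1set cards1 V3 => /(_ tV) H; suff : 6 <= #|link S t| * 1 + 2 * 2 by lia.
  apply: leq_trans S6 (H _ _) => x; rewrite !inE; first by move/eqP->.
  by case/andP=> _; apply: l2.
have e : link S t == offdiag (V :\ t) by rewrite eqEcard (link_offdiag t vS) cV.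
split=> // y z yV zV yz.
have : (y, z) \in link S t by rewrite (eqP e) in_offdiag /= yV zV.
by rewrite inE.
Qed.

End Apex.

(** * Maximum systems in which every point is involved in a tie *)

Section Unclean.
Variable T : finType.
Implicit Types (V M : {set T}) (S : {set T * T * T}) (x y z t u v w c : T).
Variables (V : {set T}) (S : {set T * T * T}).
Hypotheses (vS : valid V S) (maxS : maximum V S).
Hypothesis unclean : forall v, v \in V -> ~~ clean S v.

Definition tied := [set x in V | ties S x != set0].
Local Notation M := tied.
Local Notation K := (ties S).
Local Notation D := (strict_lower V S).
Local Notation L x := #|link S x|.

Lemma ties_sub_tied x y : y \in K x -> y \in M.
Proof.
move=> yx; have xy : x \in K y by rewrite tiesC.
have [z /(vin vS)[_ yV _] _] := tie_witness vS yx; rewrite inE yV /=.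
by apply/set0Pn; exists x.
Qed.

Lemma tied_card x : x \in M -> 0 < #|K x|.
Proof. by rewrite inE card_gt0 => /andP[]. Qed.

Lemma tied_sub : M \subset V.
Proof. by apply/subsetP=> x; rewrite inE => /andP[]. Qed.

Lemma ties_neq x y : y \in K x -> y != x.
Proof. by rewrite inE => /andP[/(beats_in vS)[]]. Qed.

Lemma untied_ties v : v \in V :\: M -> K v = set0.
Proof. by rewrite !inE => /andP[+ vV]; rewrite vV => /negPn/eqP. Qed.

(** An untied point can only fail to be clean as the third point of a tied pair. *)
Lemma untied_witness v : v \in V :\: M -> exists y z,
  [/\ y != z, (y, z, v) \in S & (z, y, v) \in S].
Proof.
move=> vW; have vV : v \in V by move: vW; rewrite in_setD => /andP[].
have := unclean vV; rewrite /clean (untied_ties vW) eqxx /=.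
case/forallPn=> y /forallPn[z]; rewrite negb_imply negbK => /andP[Sy Sz].
by exists y, z; split=> //; have [] := vneq vS Sy.
Qed.

Lemma witness_strict_lower v y z : v \in V :\: M -> (y, z, v) \in S -> v \in D y.
Proof.
move=> vW Sy; rewrite in_strict_lower (beats_lower vS (beatsI (vsym vS Sy))) andbT tiesC.
by rewrite (untied_ties vW) inE.
Qed.

Lemma witness_not_lower v y z : v \in V :\: M -> (y, z, v) \in S -> y \notin lower V S v.
Proof.
move=> vW Sy; have by_ := beatsI (vsym vS Sy); rewrite inE by_ orbF.
apply/negP=> /and3P[_ _ bv]; have := in_set0 y.
by rewrite -(untied_ties vW) inE bv by_.
Qed.

Lemma card_lower_lt x : x \in V -> #|lower V S x| < #|V|.
Proof.
move=> xV; rewrite [#|V|](cardsD1 x) xV ltnS; apply/subset_leq_card/subsetP=> y.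
by rewrite in_setD1 inE => /and3P[-> ->].
Qed.

(** Excluded are [v] and the two points of a tied pair with third point [v], which strictly beat
    it. *)
Lemma card_strict_lower_untied v : v \in V :\: M -> #|D v| <= #|V| - 3.
Proof.
move=> vW; have [y [z [yz Sy Sz]]] := untied_witness vW.
have [yV zV vV] := vin vS Sy; have [_ yv zv] := vneq vS Sy.
have -> : #|V| - 3 = #|V :\ v :\ y :\ z|.
  have := cardsD1 v V; have := cardsD1 y (V :\ v); have := cardsD1 z (V :\ v :\ y).
  by rewrite !in_setD1 yV zV vV yv zv eq_sym yz /=; clear; lia.
apply/subset_leq_card/subsetP=> t; rewrite in_strict_lower => /andP[_ tl].
have ty : t != y by apply: contraNneq (witness_not_lower vW Sy) => <-.
have tz : t != z by apply: contraNneq (witness_not_lower vW Sz) => <-.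
by move: tl; rewrite !in_setD1 ty tz inE => /and3P[-> ->].
Qed.

Lemma link_untied v : v \in V :\: M -> L v <= (#|V| - 3) * (#|V| - 4).
Proof.
move=> vW; have := card_link_le vS v; rewrite (untied_ties vW) cards0.
have := card_strict_lower_untied vW; nia.
Qed.

(** By [tied_bounds], the link has size at most k <= 5 for d = 0, 2k <= 6 for d = 1, and 2 + 2k <= 4
    for d = 2. *)
Lemma link_tied x : x \in M -> L x <= 6.
Proof.
move=> /tied_card/(tied_bounds vS maxS).
have := card_link_le vS x; have := @card_link_le0 _ _ _ vS x.
case: #|D x| => [|[|[|d]]]; lia.
Qed.

(** The total weight is 2 for a strict win, 1 + 1 for a tie, and 4 if neither point beats the
    other. *)
Lemma lower_count x y : x \in V -> y \in V -> x != y ->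
  2 <= (2 * (y \in D x) + (y \in K x)) + (2 * (x \in D y) + (x \in K y)).
Proof.
move=> xV yV xy; rewrite !in_strict_lower !inE xV yV xy eq_sym xy /=.
by case: (beats S x y); case: (beats S y x).
Qed.

(* Double counting of the pairs (x, y) with [x] tied and [y] lower than [x],
   a tied pair having weight 1/2: [tied_bounds] gives at most 5/2 per tied [x],
   and each untied [y] is the third point of a tied pair, hence strictly lower
   than at least two tied points. *)
Lemma tied_count : #|M| * (#|M| - 1) + 4 * (#|V| - #|M|) <= 5 * #|M|.
Proof.
pose f x y := 2 * (y \in D x) + (y \in K x).
have sumb (A : {set T}) : A \subset V -> \sum_(y in V) (y \in A) = #|A|.
  move=> AV; rewrite (big_setID A) /= (setIidPr AV) -sum1_card.
  rewrite [X in _ + X]big1 ?addn0 => [|y]; first by apply: eq_bigr => y ->.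
  by rewrite in_setD => /andP[/negbTE->].
have sumf x : \sum_(y in V) f x y = 2 * #|D x| + #|K x|.
  rewrite big_split /= -big_distrr /= !sumb //; apply/subsetP=> y.
    by move/ties_sub_tied; apply: (subsetP tied_sub).
  by rewrite in_strict_lower => /andP[_]; rewrite inE => /andP[].
have up : \sum_(x in M) \sum_(y in V) f x y <= 5 * #|M|.
  rewrite mulnC -sum_nat_const; apply: leq_sum => x xM; rewrite sumf.
  exact: tied_bounds vS maxS (tied_card xM).
have split : \sum_(x in M) \sum_(y in V) f x y =
    \sum_(x in M) \sum_(y in M) f x y + \sum_(x in M) \sum_(y in V :\: M) f x y.
  rewrite -big_split; apply: eq_bigr => x _ /=.
  by rewrite (big_setID M) /= (setIidPr tied_sub).
(* The sum is doubled by exchanging the indices, so that [lower_count] applies to each pair. *)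
have inner : #|M| * (#|M| - 1) <= \sum_(x in M) \sum_(y in M) f x y.
  rewrite -(leq_pmul2l (isT : 0 < 2)) [X in _ <= X]mul2n -addnn.
  rewrite {2}exchange_big -big_split /= -[X in X <= _]mulnCA -sum_nat_const.
  apply: leq_sum => x xM; rewrite -big_split /= (big_setD1 x xM) /=.
  have -> : 2 * (#|M| - 1) = \sum_(y in M :\ x) 2.
    by rewrite sum_nat_const [#|M|](cardsD1 x) xM add1n subn1 [RHS]mulnC.
  apply: leq_trans (leq_addl _ _); apply: leq_sum => y.
  rewrite in_setD1 => /andP[yx yM].
  by apply: lower_count; rewrite ?(subsetP tied_sub) // eq_sym.
have outer : 4 * (#|V| - #|M|) <= \sum_(x in M) \sum_(y in V :\: M) f x y.
  rewrite exchange_big /= -{1}(setIidPr tied_sub) -cardsD mulnC -sum_nat_const.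
  apply: leq_sum => v vW; have [y [z [yz Sy Sz]]] := untied_witness vW.
  have yK : y \in K z by rewrite inE (beatsI Sy) (beatsI Sz).
  have zK : z \in K y by rewrite tiesC.
  rewrite (bigD1 y) ?(ties_sub_tied yK) //= (bigD1 z) ?(ties_sub_tied zK) 1?eq_sym //=.
  by rewrite /f (witness_strict_lower vW Sy) (witness_strict_lower vW Sz); clear; lia.
lia.
Qed.

End Unclean.

(** * Parity of links and common third points of ties *)

Section Hub.
Variable T : finType.
Implicit Types (V M : {set T}) (S : {set T * T * T}) (x y z t u v w c : T).
Variables (V : {set T}) (S : {set T * T * T}).
Hypothesis vS : valid V S.
Local Notation M := (tied V S).
Local Notation K := (ties S).
Local Notation D := (strict_lower V S).
Local Notation L x := #|link S x|.

Lemma link_even x : odd (L x) = false.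
Proof.
pose A := [set p : T * T | enum_rank p.1 < enum_rank p.2].
have -> : L x = #|link S x :&: A| + #|link S x :&: A|.
  rewrite -{1}(cardsID A (link S x)); congr addn.
  rewrite -[RHS](card_imset (f := fun p : T * T => (p.2, p.1)));
    last by move=> [a b] [c d] [-> ->].
  apply: eq_card => [[y z]]; apply/idP/imsetP => [|[[a b]]].
    rewrite !inE /= -leqNgt => /andP[rzy Sx]; exists (z, y) => //.
    rewrite !inE /= (vsym vS Sx) /= ltn_neqAle rzy andbT.
    have [_ _] := vneq vS Sx; apply: contraNneq => /ord_inj/enum_rank_inj ->.
    exact: eqxx.
  by rewrite !inE /= => /andP[Sx ab] [-> ->]; rewrite -leqNgt (ltnW ab) (vsym vS Sx).
by rewrite addnn odd_double.
Qed.

(** If [z] were tied to [y], the third point of that tie would be [x], so [z] would beat [x], which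
    beats [z]: they would be tied. *)
Lemma tie_hub_free x y z : y \in K x -> (x, y, z) \in S -> (y, x, z) \in S ->
  z \notin K x -> z \notin K y.
Proof.
move=> yx Sx Sy; apply: contra => zy.
have [w Syz Szy] := tie_witness vS zy.
have ew := vind vS (vsym vS Sy) Szy; rewrite ew in Szy.
by rewrite inE (beatsI (vsym vS Sx)) (beatsI (vsym vS Szy)).
Qed.

(** One strictly lower point yields no pair of its own, so 2k is attained only if no pair of the
    link has both coordinates tied. The third point of each tie is thus not tied to [x], and must be
    the strictly lower point. *)
Lemma link_hub x : #|D x| = 1 -> L x = 2 * #|K x| ->
  exists2 z, D x = [set z] & forall y, y \in K x -> (x, y, z) \in S /\ (y, x, z) \in S.
Proof.
move=> /eqP/cards1P[z Dz] Lx; exists z => // y yK.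
have [w Sx Sy] := tie_witness vS yK; suff <- : w = z by [].
set A := [set p in link S x | p.1 \in ties S x].
set B := [set p in link S x | p.2 \in ties S x].
have sub : link S x \subset A :|: B.
  apply/subsetP=> p xp; rewrite in_setU [p \in A]in_set [p \in B]in_set xp.
  have [|-> //|->] := or3P (link_strict_lower vS xp); last by rewrite orbT.
  by rewrite in_offdiag Dz !inE => /and3P[/eqP-> /eqP->]; rewrite eqxx.
have cA : #|A| <= _ := link_tie_fst vS x; have cB : #|B| <= _ := link_tie_snd vS x.
have cAB := cardsUI A B; have := subset_leq_card sub => cS.
have AB0 : A :&: B = set0 by apply/eqP; rewrite -cards_eq0; lia.
have wK : w \notin K x.
  have : (y, w) \notin A :&: B by rewrite AB0 inE.
  by rewrite in_setI [_ \in A]in_set [_ \in B]in_set /= yK [_ \in link _ _]in_set Sx.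
by apply/set1P; rewrite -Dz in_strict_lower wK (beats_lower vS (beatsI (vsym vS Sx))).
Qed.

(* [x] is tied to all points but one, and that one is the third point of all
   these ties. *)
Definition hubbed x := [&& #|D x| == 1, #|K x| == #|V| - 2 & L x == 2 * #|K x|].

(** The hub [z] is untied: a point tied to [z] differs from [x], so it is tied to [x] with third
    point [z], against [tie_hub_free]. *)
Lemma hubbed_hub x : 2 < #|V| -> x \in V -> hubbed x -> exists z,
  [/\ z \in V :\: M, z != x & forall y, y \in V -> y != x -> y != z ->
    (x, y, z) \in S /\ (y, x, z) \in S].
Proof.
move=> V3 xV /and3P[/eqP Dx /eqP Kx /eqP Lx].
have [z Dz hub] := link_hub Dx Lx.
have zD : z \in D x by rewrite Dz inE.
have [zK zl] : z \notin K x /\ z \in lower V S x by move: zD;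
  rewrite in_strict_lower => /andP.
have [zV zx] : z \in V /\ z != x by move: zl; rewrite inE => /and3P[].
have low : lower V S x = V :\ x.
  apply/eqP; rewrite eqEcard (card_lower vS) Dx Kx; apply/andP; split.
    by apply/subsetP=> y; rewrite in_setD1 inE => /and3P[-> ->].
  by have := cardsD1 x V; rewrite xV; lia.
have inK y : y \in V -> y != x -> y != z -> y \in K x.
  move=> yV yx yz; apply: contraNT yz => yK; apply/eqP/set1P.
  by rewrite -Dz in_strict_lower yK low in_setD1 yx.
exists z; split=> // [|y yV yx yz]; last by apply/hub/inK.
rewrite in_setD zV andbT; apply/negP => /tied_card/card_gt0P[u uz].
have uV : u \in V by apply: (subsetP (tied_sub V S)); apply: ties_sub_tied vS _ _ uz.
have uz' := ties_neq vS uz.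
have [ux|ux] := eqVneq u x; first by rewrite -ux tiesC uz in zK.
have [Sx Su] := hub u (inK u uV ux uz').
by have := tie_hub_free (inK u uV ux uz') Sx Su zK; rewrite tiesC uz.
Qed.

(** All points but the hub [z] of [x] are tied, so [z], the only untied point, is the hub of every
    hubbed point. *)
Lemma star_hubbed x : 2 < #|V| -> x \in V -> hubbed x ->
  (forall y y', y \in M -> y' \in M -> y != y' -> hubbed y || hubbed y') ->
  exists z, star V S z.
Proof.
move=> V3 xV hx hub; have [z [zW zx hz]] := hubbed_hub V3 xV hx.
have zV : z \in V by move: zW; rewrite in_setD => /andP[].
have inM y : y \in V :\ z -> y \in M.
  rewrite in_setD1 => /andP[yz yV].
  have [->|yx] := eqVneq y x.
    have [u uV uxz] := fresh (s := [:: x; z]) V3.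
    have [ux uz] : u != x /\ u != z by apply/andP; move: uxz; rewrite !inE negb_or.
    have [S1 S2] := hz u uV ux uz.
    by apply: (@ties_sub_tied _ _ _ vS u); rewrite inE (beatsI S1) (beatsI S2).
  have [S1 S2] := hz y yV yx yz.
  by apply: (@ties_sub_tied _ _ _ vS x); rewrite inE (beatsI S1) (beatsI S2).
have hub_eq u v : v \in V :\: M -> v = z.
  rewrite in_setD => /andP[vM vV]; apply/eqP; apply: contraR vM => vz.
  by apply: inM; rewrite in_setD1 vz.
exists z; split=> // y y' yV yV' yy.
have [/andP[yz Vy] /andP[yz' Vy']] : (y != z) && (y \in V) /\ (y' != z) && (y' \in V).
  by rewrite -!in_setD1.
have [h|h] := orP (hub _ _ (inM _ yV) (inM _ yV') yy).
  have [t [tW _ ht]] := hubbed_hub V3 Vy h; have tz := hub_eq y _ tW.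
  by have [] := ht y' Vy' _ _; rewrite ?tz // eq_sym.
have [t [tW _ ht]] := hubbed_hub V3 Vy' h; have tz := hub_eq y _ tW.
by have [] := ht y Vy _ _; rewrite ?tz // eq_sym.
Qed.

End Hub.

(** * Reduction to stars on 4 or 5 points *)

Section Small.
Variable T : finType.
Implicit Types (V M : {set T}) (S : {set T * T * T}) (x y z t u v w : T).
Variables (V : {set T}) (S : {set T * T * T}).
Hypotheses (vS : valid V S) (maxS : maximum V S).
Hypothesis unclean : forall v, v \in V -> ~~ clean S v.
Local Notation M := (tied V S).
Local Notation K := (ties S).
Local Notation D := (strict_lower V S).
Local Notation L x := #|link S x|.

Lemma sum_setD1 (A : {set T}) x (F : T -> nat) : x \in A ->
  \sum_(y in A) F y = F x + \sum_(y in A :\ x) F y.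
Proof. exact: big_setD1. Qed.

Lemma card_link_in : #|S| = \sum_(x in V) L x.
Proof.
rewrite card_link (bigID (mem V)) /= [X in _ + X]big1 ?addn0 // => x xV.
exact: link_out vS xV.
Qed.

Lemma tied_data x : x \in M -> [/\ 0 < #|K x|, 2 * #|D x| + #|K x| <= 5,
  #|D x| + #|K x| < #|V|, L x <= #|D x| * (#|D x| - 1) + 2 * #|K x|
  & #|D x| = 0 -> L x <= #|K x|].
Proof.
move=> xM; have k0 := tied_card xM; have xV := subsetP (tied_sub V S) _ xM.
split=> //; first exact: tied_bounds vS maxS k0.
- by rewrite -(card_lower vS) card_lower_lt.
- exact: card_link_le.
exact: card_link_le0.
Qed.

(** [b] bounds the links of tied points that are not hubbed, [c] those of all tied points. The first
    size condition forces a hubbed point, whose hub is untied; by the second, two tied points that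
    are not hubbed, the hub and n-3 further points count too little. *)
Lemma star_of_bounds b c : 3 < #|V| ->
  (forall x, x \in M -> hubbed V S x || (L x <= b)) ->
  (forall x, x \in M -> L x <= c) ->
  (#|V| - 3) * (#|V| - 4) <= b -> b <= c ->
  b * #|V| < #|S| -> 2 * b + (#|V| - 3) * (#|V| - 4) + (#|V| - 3) * c < #|S| ->
  exists z, star V S z.
Proof.
move=> V3 hub Lc wb bc bS cS.
have [x xM hx] : exists2 x, x \in M & hubbed V S x.
  apply/exists_inP; apply: contraLR bS => /exists_inPn no; rewrite -leqNgt.
  rewrite card_link_in mulnC -sum_nat_const; apply: leq_sum => x xV.
  have [xM|xM] := boolP (x \in M); first by have := hub x xM;
    rewrite (negbTE (no x xM)).
  by apply: leq_trans wb; apply: link_untied; rewrite // in_setD xM.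
have xV := subsetP (tied_sub V S) _ xM.
have [z [zW _ _]] := hubbed_hub vS (ltnW V3) xV hx.
apply: (star_hubbed vS (ltnW V3) xV hx) => y y' yM y'M yy'.
apply: contraLR cS; rewrite negb_or => /andP[ny ny']; rewrite -leqNgt.
have Ly : L y <= b by have := hub y yM; rewrite (negbTE ny).
have Ly' : L y' <= b by have := hub y' y'M; rewrite (negbTE ny').
have Lz := link_untied vS unclean zW.
have [yV y'V] := (subsetP (tied_sub V S) _ yM, subsetP (tied_sub V S) _ y'M).
have [zM zV] : z \notin M /\ z \in V by move: zW; rewrite in_setD => /andP.
have zy : z != y by apply: contraNneq zM => ->.
have zy' : z != y' by apply: contraNneq zM => ->.
have yV' : y' \in V :\ y by rewrite in_setD1 eq_sym yy'.
have zV' : z \in V :\ y :\ y' by rewrite !in_setD1 zy zy'.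
rewrite card_link_in (sum_setD1 _ yV) (sum_setD1 _ yV') (sum_setD1 _ zV').
have cV : #|V :\ y :\ y' :\ z| = #|V| - 3.
  have := cardsD1 y V; have := cardsD1 y' (V :\ y); have := cardsD1 z (V :\ y :\ y').
  by rewrite zV' yV' yV; clear; lia.
rewrite mul2n -addnn -!addnA; do 3 apply: leq_add => //.
rewrite -cV -sum_nat_const; apply: leq_sum => w; rewrite !in_setD1 => /and4P[_ _ _ wV].
have [wM|wM] := boolP (w \in M); first exact: Lc.
apply: leq_trans bc; apply: leq_trans wb; apply: link_untied => //.
by rewrite in_setD wM.
Qed.

(** Let [t] be the third point of the tie of [x] and [y], and [u] the fourth point. The link of [t]
    is empty and no link exceeds 4, so that of [u] has size 4. But [u] is tied at most to [y], and
    [x] is not lower than [u], which allows only 2. *)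
Lemma not_two_strictly_lower x : #|V| = 4 -> 12 <= #|S| -> x \in V ->
  #|D x| = 2 -> #|K x| = 1 -> L x = 4 -> False.
Proof.
move=> V4 S12 xV D2 /eqP/cards1P[y Ky] L4.
have yK : y \in K x by rewrite Ky inE.
have [t Sx Sy] := tie_witness vS yK.
have [_ yV tV] := vin vS Sx; have [xy xt yt] := vneq vS Sx.
have tK : t \notin K x by rewrite Ky inE eq_sym.
have tD : t \in D x by rewrite in_strict_lower tK (beats_lower vS (beatsI (vsym vS Sx))).
have /eqP/cards1P[u Du] : #|D x :\ t| = 1 by have := cardsD1 t (D x);
  rewrite tD D2 => -[].
have [ut uD] : u != t /\ u \in D x by apply/andP; rewrite -in_setD1 Du inE.
have [uK ul] : u \notin K x /\ u \in lower V S x by move: uD;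
  rewrite in_strict_lower => /andP.
have [uV ux] : u \in V /\ u != x by move: ul; rewrite inE => /and3P[].
have uy : u != y by apply: contraNneq uK => ->.
have Dtu w : w \in D x -> w = t \/ w = u.
  move=> wD; have [|wt] := eqVneq w t; first by left.
  by right; apply/set1P; rewrite -Du in_setD1 wt.
have Vxytu w : w \in V -> [|| w == x, w == y, w == t | w == u].
  have : #|[set x; y; t; u]| = 4.
    by rewrite -!setUA !cardsU1 cards1 !inE !negb_or xy xt ![_ == u]eq_sym ux uy ut yt.
  move=> c4 wV; have sub : [set x; y; t; u] \subset V.
    by apply/subsetP=> a; rewrite !inE -!orbA => /or4P[] /eqP->.
  have /eqP eV : [set x; y; t; u] == V by rewrite eqEcard sub c4 V4.
  by move: wV; rewrite -eV !inE -!orbA.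
(* Otherwise the link of [x] would only hold the two orders of y, t. *)
have Sxtu : (x, t, u) \in S.
  apply/negPn/negP => nS; have : link S x \subset [set (y, t); (t, y)].
    apply/subsetP=> [[a b]] ab; have Sab : (x, a, b) \in S by move: ab; rewrite inE.
    have := link_strict_lower vS ab; rewrite in_offdiag Ky !in_set1 /=.
    case/or3P=> [/and3P[/Dtu aD /Dtu bD anb]|/eqP ay|/eqP yb].
    - case: aD bD => ea [] eb; subst a b; rewrite ?eqxx // in anb.
        by rewrite Sab in nS.
      by rewrite (vsym vS Sab) in nS.
    - by rewrite ay in Sab *; rewrite (tie_uniq vS yK Sab Sx) !inE eqxx.
    by rewrite yb in Sab *; rewrite (tie_uniq vS yK (vsym vS Sab) Sx) !inE eqxx orbT.
  by move/subset_leq_card; rewrite L4 leqNgt ltnS cards2; case: (_ != _).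
have tKy := tie_hub_free vS yK Sx Sy tK.
have bxt := beatsI Sxtu; have byt := beatsI (vsym vS Sy).
have ntx : ~~ beats S t x by apply: contra tK; rewrite inE bxt.
have nty : ~~ beats S t y by apply: contra tKy; rewrite inE byt.
(* The third point of such a tie would be [x] or [y], which [t] does not beat. *)
have utK : u \notin K t.
  apply/negP=> /(tie_witness vS)[w Stu Sut]; have [_ _ wV] := vin vS Stu.
  have [_ tw uw] := vneq vS Stu.
  case/or4P: (Vxytu w wV) => /eqP ew; subst w; last 2 first.
  - by rewrite eqxx in tw.
  - by rewrite eqxx in uw.
  - by have := beatsI (vsym vS Stu); rewrite (negbTE ntx).
  by have := beatsI (vsym vS Stu); rewrite (negbTE nty).
have tM : t \notin M.
  apply/negP=> /tied_card/card_gt0P[w wK].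
  have wV := subsetP (tied_sub V S) _ (ties_sub_tied vS wK).
  case/or4P: (Vxytu w wV) => /eqP ew; subst w.
  - by rewrite tiesC (negbTE tK) in wK.
  - by rewrite tiesC (negbTE tKy) in wK.
  - by have := ties_neq vS wK; rewrite eqxx.
  by rewrite (negbTE utK) in wK.
have L0 v : v \in V :\: M -> L v = 0.
  by move=> /(link_untied vS unclean); rewrite V4 muln0 leqn0 => /eqP.
have L4' v : v \in V -> L v <= 4.
  move=> vV; have [vM|vM] := boolP (v \in M); last by rewrite L0 // in_setD vM.
  have [k0 dk dkV Ld Ld0] := tied_data vM; rewrite V4 in dkV.
  move: k0 dk dkV Ld Ld0; clear; case: #|D v| => [|[|[|d]]]; lia.
have Lu : 4 <= L u.
  have yV' : y \in V :\ x by rewrite in_setD1 eq_sym xy.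
  have tV' : t \in V :\ x :\ y by rewrite !in_setD1 ![t == _]eq_sym xt yt.
  have e : V :\ x :\ y :\ t = [set u].
    apply/setP=> w; rewrite !inE; apply/and4P/eqP=> [[wt wy wx wV]|->].
      by case/or4P: (Vxytu w wV) wt wy wx => /eqP-> //; rewrite eqxx.
    by [].
  move: S12; rewrite card_link_in (sum_setD1 _ xV) (sum_setD1 _ yV').
  rewrite (sum_setD1 _ tV') e big_set1.
  rewrite (L0 t) ?in_setD ?tM //; have := L4' y yV; have := L4' x xV; clear; lia.
have uM : u \in M.
  by apply: contraLR Lu => uM; rewrite L0 // in_setD uM.
have [k0 _ _ Ld _] := tied_data uM.
have k1 : #|K u| <= 1.
  rewrite -(cards1 y); apply/subset_leq_card/subsetP=> w wK; rewrite inE.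
  have wV := subsetP (tied_sub V S) _ (ties_sub_tied vS wK).
  case/or4P: (Vxytu w wV) => /eqP ew //; subst w.
  - by rewrite tiesC (negbTE uK) in wK.
  - by rewrite tiesC (negbTE utK) in wK.
  by have := ties_neq vS wK; rewrite eqxx.
have lu : #|lower V S u| <= 2.
  have bxu := beatsI (vsym vS Sxtu).
  have xl : x \notin lower V S u.
    apply: contra uK; rewrite !inE bxu orbF => /and3P[_ _ ->]. 
    by rewrite andbT.
  have e : lower V S u \subset [set y; t].
    apply/subsetP=> w wl; have [wV wu] : w \in V /\ w != u by move: wl;
      rewrite inE => /and3P[].
    rewrite !inE; case/or4P: (Vxytu w wV) wl wu => /eqP-> //; rewrite ?eqxx ?orbT //.
    by rewrite (negbTE xl).
  by apply: leq_trans (subset_leq_card e) _; rewrite cards2; case: (_ != _).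
rewrite (card_lower vS) in lu.
move: k0 Ld k1 lu Lu; clear; case: #|D u| => [|[|d]]; lia.
Qed.

Lemma unclean_star : 3 < #|V| -> 2 * ('C(#|V|, 3) + 2) <= #|S| ->
  #|V| <= 5 /\ exists z, star V S z.
Proof.
move=> V3 bS.
have cnt := tied_count vS maxS unclean.
have cM := subset_leq_card (tied_sub V S).
(* With m tied points, [cnt] reads 4n <= m(10-m) <= 25. *)
have V6 : #|V| <= 6 by move: cnt cM; clear; nia.
have V5 : #|V| <= 5.
  (* For n = 6 all links have size at most 6, so at most 36 elements face the required 44. *)
  rewrite leqNgt; apply/negP=> V7; have V6' : #|V| = 6 by apply/eqP; rewrite eqn_leq V6.
  have := card_link_sum vS (tied_sub V S) (fun x => link_tied vS maxS (x := x))
    (fun v => link_untied vS unclean (v := v)).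
  by move: bS cM; rewrite V6' [2 * _](_ : _ = 44) //; clear; lia.
split=> //.
have [V5'|V4] : #|V| = 5 \/ #|V| = 4 by move: V3 V5; clear; lia.
  rewrite V5' [2 * _](_ : _ = 24) // in bS.
  (* 5·4 = 20 and 2·4 + 2 + 2·6 = 22 are below 24; the value 4 uses that links are even. *)
  apply: (@star_of_bounds 4 6); rewrite ?V5' //; try by move: bS; clear; lia.
    move=> x xM; have [k0 dk dkV Ld Ld0] := tied_data xM; have ev := link_even vS x.
    rewrite /hubbed; move: k0 dk dkV Ld Ld0 ev; rewrite V5'; clear.
    case: #|D x| => [|[|[|d]]]; lia.
  exact: link_tied.
rewrite V4 [2 * _](_ : _ = 12) // in bS.
(* 4·2 and 2·2 + 0 + 4 are below 12; the value 2 uses parity and [not_two_strictly_lower]. *)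
apply: (@star_of_bounds 2 4); rewrite ?V4 //; try by move: bS; clear; lia.
  move=> x xM; have [k0 dk dkV Ld Ld0] := tied_data xM; have ev := link_even vS x.
  have no := not_two_strictly_lower V4 bS (subsetP (tied_sub V S) _ xM).
  rewrite /hubbed; move: k0 dk dkV Ld Ld0 ev no; rewrite V4; clear.
  case: #|D x| => [|[|[|d]]]; lia.
move=> x xM; have [k0 dk dkV Ld Ld0] := tied_data xM.
move: k0 dk dkV Ld Ld0; rewrite V4; clear; case: #|D x| => [|[|[|d]]]; lia.
Qed.
End Small.

(** * Extremal systems *)

Section Extremal.
Variable T : finType.
Implicit Types (V M : {set T}) (S : {set T * T * T}) (x y z t u v w c : T).

Definition bound n := 2 * ('C(n, 3) + 2).

Lemma boundS n : 2 < n -> bound n = (n - 1) * (n - 2) + bound (n - 1).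
Proof.
case: n => // n n2; rewrite /bound subn1 /= binS.
have := mul_bin_diag n 1; rewrite bin1.
have -> : n.+1 - 2 = n.-1 by lia.
lia.
Qed.

Lemma card_setD1 V x n : x \in V -> #|V| = n.+1 -> #|V :\ x| = n.
Proof. by move=> xV; rewrite (cardsD1 x) xV => -[]. Qed.

(** A point [a] winning {a, t, c} would clash with {t, a, z}, won by [t], for a fourth point [z]. *)
Lemma apex_split V S t : valid V S -> 3 < #|V| -> apex V S t ->
  S = fan t (V :\ t) :|: delete S t.
Proof.
move=> vS V3 [tV apt]; have no a c : (a, t, c) \notin S.
  apply/negP=> Sa; have [aV _ cV] := vin vS Sa; have [at_ ac tc] := vneq vS Sa.
  have [z zV zs] := fresh (s := [:: t; a; c]) V3.
  have [zt [za zc]] : z != t /\ z != a /\ z != c.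
    by move: zs; rewrite !inE !negb_or => /and3P[].
  have St : (t, a, z) \in S by apply: apt; rewrite ?in_setD1 ?at_ ?zt // eq_sym.
  by move: zc; rewrite (vind vS Sa St) eqxx.
apply/setP=> [[[a b] c]]; rewrite in_setU in_fan in_delete.
have [->|ta] /= := eqVneq a t.
  rewrite andbF orbF; apply/idP/and3P=> [Sabc|[bV cV bc]]; last exact: apt.
  have [_ bV cV] := vin vS Sabc; have [tb tc bc] := vneq vS Sabc.
  by rewrite !in_setD1 ![_ == t]eq_sym tb tc.
have [->|tb] /= := eqVneq b t; first by rewrite andbF (negbTE (no _ _)).
have [->|tc] /= := eqVneq c t; last by rewrite andbT.
by rewrite andbF; apply: contraNF (no a b) => /(vsym vS).
Qed.

Lemma apex_card V S t : valid V S -> 3 < #|V| -> apex V S t ->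
  #|S| = (#|V| - 1) * (#|V| - 2) + #|delete S t|.
Proof.
move=> vS V3 ap; rewrite {1}(apex_split vS V3 ap) card_fanU ?valid_delete //.
by case: ap.
Qed.

(** The centre wins nothing, since {c, a, b} would clash with a triple {a, c, w}, w != b, won by
    [a]; a triple avoiding [c] would clash with a tie through [c]. *)
Lemma starE V S c x y z : valid V S -> 3 < #|V| -> star V S c ->
  x \in V -> y \in V -> z \in V -> x != y -> x != z -> y != z ->
  ((x, y, z) \in S) = (y == c) || (z == c).
Proof.
move=> vS V3 [cV st] xV yV zV xy xz yz; have no a b : (c, a, b) \notin S.
  apply/negP=> Sc; have [_ aV bV] := vin vS Sc; have [ca cb ab] := vneq vS Sc.
  have [w wV ws] := fresh (s := [:: c; a; b]) V3.
  have [wc [wa wb]] : w != c /\ w != a /\ w != b.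
    by move: ws; rewrite !inE !negb_or => /and3P[].
  have Sa : (a, w, c) \in S by apply: st; rewrite ?in_setD1 ?wc // eq_sym ?ca.
  by move: wb; rewrite (vind vS Sc (vsym vS Sa)) eqxx.
apply/idP/orP=> [Sx|].
  apply/orP; apply/negPn; rewrite negb_or; apply/negP=> /andP[yc zc].
  have xc : x != c by apply: contraTneq Sx => ->.
  have Sy : (y, x, c) \in S by apply: st; rewrite ?in_setD1 ?xc ?yc // eq_sym.
  by move: zc; rewrite (vind vS Sx Sy) eqxx.
by case=> /eqP ec; subst c; [apply: (vsym vS)|];
   apply: st; rewrite ?in_setD1 ?xy ?xz ?yz // eq_sym yz.
Qed.

Lemma star_card_le V S c : valid V S -> 3 < #|V| -> star V S c ->
  #|S| <= 2 * ((#|V| - 1) * (#|V| - 2)).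
Proof.
move=> vS V3 stc; have cV : c \in V by case: stc.
pose A : {set T * T * T} := [set (p.1, p.2, c) | p in offdiag (V :\ c)].
pose B : {set T * T * T} := [set (p.1, c, p.2) | p in offdiag (V :\ c)].
have co : #|offdiag (V :\ c)| = (#|V| - 1) * (#|V| - 2).
  by rewrite card_offdiag [#|V|](cardsD1 c) cV; congr (_ * _); lia.
have cA : #|A| <= (#|V| - 1) * (#|V| - 2) by rewrite -co leq_imset_card.
have cB : #|B| <= (#|V| - 1) * (#|V| - 2) by rewrite -co leq_imset_card.
have sub : S \subset A :|: B.
  apply/subsetP=> [[[x y] z]] Sx.
  have [xV yV zV] := vin vS Sx; have [xy xz yz] := vneq vS Sx.
  move: (Sx); rewrite (starE vS V3 stc) // in_setU => /orP[] /eqP e; subst c.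
    apply/orP; right; apply/imsetP; exists (x, z) => //.
    by rewrite in_offdiag /= !in_setD1 xV zV xz xy eq_sym yz.
  apply/orP; left; apply/imsetP; exists (x, y) => //.
  by rewrite in_offdiag /= !in_setD1 xV yV xz xy yz.
have := subset_leq_card sub; have := (leq_card_setU A B).1; move: cA cB; clear; lia.
Qed.

Lemma maximum_exists V : exists2 S, valid V S & maximum V S.
Proof.
have v0 : valid V set0 by apply/validP; split=> [x y z|x y z|x y z|x y z w];
  rewrite in_set0.
have := @arg_maxnP _ set0 (valid V) (fun S : {set T * T * T} => #|S|) v0.
by case=> S vS maxS; exists S => // S' vS'; apply: maxS.
Qed.

(** Removing a clean point loses exactly (n-1)(n-2) elements, so the lower bound is inherited, and
    an apex results even if a star remains. Without clean points [unclean_star] applies. *)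
Lemma maximum_extremal n V S : #|V| = n.+3 -> valid V S -> maximum V S ->
  bound n.+3 <= #|S| -> #|S| = bound n.+3 /\
  ((exists t, apex V S t) \/ [/\ 3 < #|V|, #|V| <= 5 & exists c, star V S c]).
Proof.
elim: n V S => [|n IH] V S Vn vS maxS bS.
  have b3 : bound 3 = 6 by [].
  have S6 : #|S| <= 6.
    have := card_link_sum (a := 2) (b := 0) vS (subxx V).
    rewrite Vn => H; apply: H => x; last by rewrite setDv inE.
    move=> xV; apply: leq_trans (subset_leq_card (link_offdiag x vS)) _.
    by rewrite card_offdiag (card_setD1 xV Vn).
  split; first by apply/eqP; rewrite eqn_leq bS b3 S6.
  have /card_gt0P[t tV] : 0 < #|V| by rewrite Vn.
  by left; exists t; apply: apex3.
have V3 : 3 < #|V| by rewrite Vn.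
have [/exists_inP[v vV cl]|/exists_inPn un] := boolP [exists v in V, clean S v].
  have [cS cover] := clean_delete vV vS maxS cl.
  have cD : #|V :\ v| = n.+3 := card_setD1 vV Vn.
  have bS' : bound n.+4 = (#|V| - 1) * (#|V| - 2) + bound n.+3.
    by rewrite boundS // Vn !subSS !subn0.
  have bD : bound n.+3 <= #|delete S v|.
    by move: bS; rewrite bS' -cS leq_add2l.
  have [eD apst] := IH _ _ cD (valid_delete v vS) (maximum_delete vV vS maxS cS) bD.
  split; first by rewrite -cS eD bS'.
  left; case: apst => [[t ap]|[_ _ [c st]]].
    exact: apex_delete vS vV cl V3 cover t ap.
  by exists v; apply: star_delete vS vV cl V3 cover c st.
have bS' : 2 * ('C(#|V|, 3) + 2) <= #|S| by rewrite Vn.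
have [V5 [c st]] := unclean_star vS maxS un V3 bS'.
split; last by right; split=> //; exists c.
(* 2(n-1)(n-2) equals [bound n] for n = 4 and n = 5. *)
have := star_card_le vS V3 st; rewrite Vn !subSS !subn0 => Sle.
apply/eqP; rewrite eqn_leq bS andbT; apply: leq_trans Sle _.
by move: V5; rewrite Vn; case: (n) => [|[|]].
Qed.

(** A maximum system beyond the bound would satisfy the hypothesis of [maximum_extremal], which
    gives equality. *)
Lemma valid_le V S : 2 < #|V| -> valid V S -> #|S| <= bound #|V|.
Proof.
move=> V3 vS; have [S' vS' maxS'] := maximum_exists V.
apply: leq_trans (maxS' S vS) _; rewrite leqNgt; apply/negP=> bS'.
case eV: #|V| V3 => [|[|[|n]]] // _; rewrite eV in bS'.
by have [e _] := maximum_extremal eV vS' maxS' (ltnW bS'); rewrite e ltnn in bS'.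
Qed.

Lemma extremal V S : 2 < #|V| -> valid V S -> #|S| = bound #|V| ->
  (exists t, apex V S t) \/ [/\ 3 < #|V|, #|V| <= 5 & exists c, star V S c].
Proof.
move=> V3 vS eS; have maxS : maximum V S.
  by move=> S' vS'; rewrite eS; apply: valid_le.
case eV: #|V| V3 => [|[|[|n]]] // _; rewrite -eV.
by have [] := maximum_extremal eV vS maxS _; rewrite -?eV ?eS.
Qed.

Lemma extremal_exists n V : #|V| = n.+3 -> exists2 S, valid V S & #|S| = bound n.+3.
Proof.
elim: n V => [|n IH] V Vn.
  pose S := [set p : T * T * T | [&& [&& p.1.1 \in V, p.1.2 \in V & p.2 \in V],
    p.1.1 != p.1.2, p.1.1 != p.2 & p.1.2 != p.2]].
  have inS x y z : ((x, y, z) \in S) = [&& [&& x \in V, y \in V & z \in V],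
      x != y, x != z & y != z] by rewrite inE.
  have vS : valid V S.
    apply/validP; split=> [x y z|x y z|x y z|x y z w]; rewrite !inS.
    - by case/and3P=> /and3P[].
    - by case/and3P=> _ -> /andP[].
    - by case/and3P=> /and3P[-> -> ->] -> /andP[-> yz]; rewrite eq_sym.
    case/and3P=> /and3P[xV yV zV] xy /andP[xz yz] /and3P[/and3P[_ _ wV] _ /andP[yw xw]].
    apply/eqP; apply: contraTT (isT : 3 < 4) => wz; rewrite -{1}Vn -leqNgt.
    have <- : #|[set x; y; z; w]| = 4.
      by rewrite -!setUA !cardsU1 cards1 !inE !negb_or xy xz yz xw yw [z == w]eq_sym wz.
    by apply/subset_leq_card/subsetP=> a; rewrite !inE -!orbA => /or4P[] /eqP->.
  exists S => //; rewrite (card_link_in vS).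
  have -> : bound 3 = #|V| * 2 by rewrite Vn.
  rewrite -sum_nat_const; apply: eq_bigr => x xV.
  have -> : link S x = offdiag (V :\ x).
    apply/setP=> [[y z]]; rewrite in_offdiag [LHS]in_set inS !in_setD1 /= xV.
    by rewrite ![_ == x]eq_sym; case: (x == y); case: (x == z); case: (y \in V);
      case: (z \in V).
  by rewrite card_offdiag (card_setD1 xV Vn).
have /card_gt0P[v vV] : 0 < #|V| by rewrite Vn.
have cD : #|V :\ v| = n.+3 := card_setD1 vV Vn.
have [S vS eS] := IH _ cD; exists (fan v (V :\ v) :|: S); first exact: valid_fan.
by rewrite card_fanU // eS Vn [RHS]boundS // !subSS !subn0.
Qed.

(* [ranked j n i a b]: the point at position [i] of an order of [n] points
   belongs to the triple formed with positions [a], [b] in the model whose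
   exceptional part consists of the last [j] positions. *)
Definition ranked j n i a b : bool :=
  [&& i < n - j, i < a & i < b]
  || [&& n - j <= a, n - j <= b & [|| j == 3, a == n.-1 | b == n.-1]].

(** The apexes come first, in order of removal; then the full triple (j = 3) or the star (j = 4, 5)
    with its centre last. *)
Lemma extremal_order n V S : #|V| = n.+3 -> valid V S -> #|S| = bound n.+3 ->
  exists l (j : nat), [/\ uniq l, l =i V, [|| j == 3, j == 4 | j == 5], j <= n.+3 &
    forall x y z, x \in V -> y \in V -> z \in V -> x != y -> x != z -> y != z ->
      ((x, y, z) \in S) = ranked j n.+3 (index x l) (index y l) (index z l)].
Proof.
elim: n V S => [|n IH] V S Vn vS eS.
  exists (enum V), 3; split=> // [|x|x y z xV yV zV xy xz yz].
  - exact: enum_uniq.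
  - exact: mem_enum.
  have S6 : 6 <= #|S| by rewrite eS.
  have [_ ap] := apex3 vS Vn S6 xV.
  by rewrite /ranked subnn /= ap // in_setD1 eq_sym ?xy ?xz.
have V3 : 3 < #|V| by rewrite Vn.
case: (extremal (ltnW V3) vS _) => [|[t ap]|[_ V5 [c st]]]; first by rewrite Vn.
  have tV : t \in V by case: ap.
  have cD : #|V :\ t| = n.+3 := card_setD1 tV Vn.
  have eD : #|delete S t| = bound n.+3.
    have := apex_card vS V3 ap; rewrite eS Vn boundS // !subSS !subn0.
    by move/eqP; rewrite eqn_add2l => /eqP.
  have [l [j [ul lV j345 jn rk]]] := IH _ _ cD (valid_delete t vS) eD.
  exists (t :: l), j; split=> // [|x||x y z xV yV zV xy xz yz].
  - by rewrite /= ul lV in_setD1 eqxx.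
  - by rewrite in_cons lV in_setD1; case: eqVneq => // ->.
  - exact: leqW.
  have j0 : 0 < j by case/or3P: j345 => /eqP->.
  have sz : n.+4 - j = (n.+3 - j).+1 by rewrite subSn.
  rewrite (apex_split vS V3 ap) in_setU in_fan in_delete /= ![_ == t]eq_sym /ranked sz.
  have [tx|tx] := eqVneq t x.
    by subst x; rewrite !in_setD1 ![_ == t]eq_sym (negbTE xy) (negbTE xz) yV zV yz.
  have [ty|ty] := eqVneq t y; first by rewrite /= !andbF.
  have [tz|tz] := eqVneq t z; first by rewrite /= !andbF.
  rewrite /= !ltnS !eqSS andbT.
  have -> : ((x, y, z) \in S) = ((x, y, z) \in delete S t).
    by rewrite in_delete ![_ == t]eq_sym tx ty tz !andbT.
  by rewrite rk // in_setD1 eq_sym ?tx ?ty ?tz.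
have [cV uE] : c \in V /\ c \notin enum (V :\ c) by rewrite mem_enum in_setD1 eqxx;
  case: st.
exists (rcons (enum (V :\ c)) c), n.+4; split.
- by rewrite rcons_uniq uE enum_uniq.
- by move=> x; rewrite mem_rcons in_cons mem_enum in_setD1; case: eqVneq => // ->.
- by move: V5; rewrite Vn; case: (n) => [|[|]].
- by [].
move=> x y z xV yV zV xy xz yz; rewrite (starE vS V3 st) // /ranked subnn /=.
have idx w : w \in V -> (index w (rcons (enum (V :\ c)) c) == n.+3) = (w == c).
  move=> wV; rewrite -cats1 index_cat mem_enum in_setD1 wV andbT.
  have cE : size (enum (V :\ c)) = n.+3.
    by rewrite -cardE (card_setD1 cV Vn).
  case: (eqVneq w c) => [->|wc] /=; first by rewrite eqxx addn0 cE eqxx.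
  apply/negbTE; rewrite -cE neq_ltn index_mem mem_enum in_setD1 wc wV //.
by rewrite !idx.
Qed.

End Extremal.

(** * Flags as pointed triples *)

Section Flags.
Variable n : nat.
Hypothesis n5 : 4 < n.
Local Notation flagn := (flag n 1 (n - 2)).
Local Notation adj := (@Gamma_adj n 1 (n - 2)).
Implicit Types (f g : flagn) (x y z : 'I_n) (S : {set flagn}).

(* The flag ({x}, [n] \ {y, z}) is encoded by the ordered triples (x, y, z)
   and (x, z, y). *)
Definition codes f (p : 'I_n * 'I_n * 'I_n) : bool :=
  (f.1 == [set p.1.1]) && (f.2 == ~: [set p.1.2; p.2]).

Lemma codesP f x y z : codes f (x, y, z) ->
  [/\ f.1 = [set x], f.2 = ~: [set y; z] & [&& x != y, x != z & y != z]].
Proof.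
case/andP=> /eqP /= e1 /eqP e2; split=> //; case: f e1 e2 => [[A B] /=].
move=> /and3P[/= AB _ /eqP Bn] eA eB; subst A B.
move: AB; rewrite sub1set !inE negb_or => /andP[-> ->] /=.
apply/negP=> /eqP yz; move: Bn; rewrite yz setUid cardsC1 card_ord.
by move: n5; clear; lia.
Qed.

Lemma codes_exists f : exists p, codes f p.
Proof.
have /and3P[_ /cards1P[x fx] /eqP fB] := flagP f.
have B2 : #|~: f.2| == 2.
  by rewrite cardsCs setCK card_ord fB; move: n5; clear; lia.
have /cards2P[y [z [_ fyz]]] := B2.
by exists (x, y, z); rewrite /codes /= fx -fyz setCK !eqxx.
Qed.

Lemma codes_sym f x y z : codes f (x, y, z) = codes f (x, z, y).
Proof. by rewrite /codes /= setUC. Qed.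

Lemma codes_inj f g p : codes f p -> codes g p -> f = g.
Proof.
move=> /andP[/eqP f1 /eqP f2] /andP[/eqP g1 /eqP g2]; apply: val_inj.
by rewrite /= [val f]surjective_pairing [val g]surjective_pairing f1 f2 g1 g2.
Qed.

Lemma set2_inj x y x' y' : [set x; y] = [set x'; y'] ->
  (x = x' /\ y = y') \/ (x = y' /\ y = x').
Proof.
move=> e; have: x \in [set x'; y'] by rewrite -e !inE eqxx.
have: y \in [set x'; y'] by rewrite -e !inE eqxx orbT.
have: x' \in [set x; y] by rewrite e !inE eqxx.
have: y' \in [set x; y] by rewrite e !inE eqxx orbT.
rewrite !inE.
move=> /orP[] /eqP-> /orP[] /eqP-> /orP[] /eqP e1 /orP[] /eqP e2; subst; tauto.
Qed.

Lemma codes_fun f x y z x' y' z' : codes f (x, y, z) -> codes f (x', y', z') ->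
  x = x' /\ ((y = y' /\ z = z') \/ (y = z' /\ z = y')).
Proof.
move=> /andP[/eqP /= f1 /eqP f2] /andP[/eqP /= g1 /eqP g2]; split.
  by apply: set1_inj; rewrite -f1.
by apply/set2_inj/setC_inj; rewrite -f2.
Qed.

Lemma general_position_small (X Y : {set 'I_n}) : #|X| + #|Y| < n ->
  general_position X Y = (X :&: Y == set0).
Proof.
move=> XY; rewrite /general_position; case: eqP => //= e.
by have := (leq_card_setU X Y).1; rewrite e cardsT card_ord; move: XY; clear; lia.
Qed.

(** The complements are disjoint only if [X] and [Y] cover all n points. *)
Lemma general_position_big (X Y : {set 'I_n}) : #|X| + #|Y| < n ->
  general_position (~: X) (~: Y) = (X :&: Y == set0).
Proof.
have C0 (Z : {set 'I_n}) : (~: Z == setT) = (Z == set0).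
  by rewrite -setC0 (inj_eq (@setC_inj _)).
have CT (Z : {set 'I_n}) : (~: Z == set0) = (Z == setT).
  by rewrite -setCT (inj_eq (@setC_inj _)).
move=> XY; rewrite /general_position -setCI -setCU C0 CT.
have [//|/= _] := eqVneq (X :&: Y) set0; apply/eqP=> e.
by have := (leq_card_setU X Y).1; rewrite e cardsT card_ord; move: XY; clear; lia.
Qed.

Lemma general_position_mixed x (Y : {set 'I_n}) : #|Y| = 2 ->
  general_position [set x] (~: Y) = (x \in Y).
Proof.
move=> Y2; rewrite /general_position setI_eq0 disjoints1 inE negbK.
case: eqP => //= e; have sY : Y \subset [set x].
  apply/subsetP=> y yY; have := in_setT y.
  by rewrite -e in_setU [y \in ~: _]in_setC yY orbF.
by have := subset_leq_card sY; rewrite Y2 cards1.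
Qed.

(** Membership of x in {y', z'} already gives x != x', and 2 + 2 < n brings the complements under
    [general_position_big]. *)
Lemma adjE f g x y z x' y' z' : codes f (x, y, z) -> codes g (x', y', z') ->
  adj f g = [&& x \in [set y'; z'], x' \in [set y; z]
              & [set y; z] :&: [set y'; z'] == set0].
Proof.
move=> /codesP[f1 f2 /and3P[xy xz yz]] /codesP[g1 g2 /and3P[xy' xz' yz']].
have c2 : #|[set y; z]| = 2 by rewrite cards2 yz.
have c2' : #|[set y'; z']| = 2 by rewrite cards2 yz'.
rewrite /Gamma_adj f1 f2 g1 g2 general_position_small ?cards1 ?(ltn_trans _ n5) //.
rewrite general_position_mixed // general_position_big ?c2 ?c2' //.
rewrite [general_position (~: _) [set _]](_ : _ =
  general_position [set x'] (~: [set y; z])); last first.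
  by rewrite /general_position setUC setIC.
rewrite general_position_mixed // setI_eq0 disjoints1 inE.
have [xin|//] := boolP (x \in [set y'; z']); rewrite ?andbF //=.
by case: eqP xin => //= ->; rewrite !inE (negbTE xy') (negbTE xz').
Qed.

Definition triples (S : {set flagn}) : {set 'I_n * 'I_n * 'I_n} :=
  [set p | [exists f in S, codes f p]].

Lemma triplesE S f p : codes f p -> (p \in triples S) = (f \in S).
Proof.
move=> fp; rewrite inE; apply/exists_inP/idP => [[g gS gp]|fS]; last by exists f.
by rewrite (codes_inj fp gp).
Qed.

Lemma triplesP S p : reflect (exists2 f, f \in S & codes f p) (p \in triples S).
Proof. by rewrite inE; apply: exists_inP. Qed.

(** A flag has exactly two codes, exchanged by [swap]; [g] picks one. *)
Lemma card_triples S : #|triples S| = 2 * #|S|.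
Proof.
pose g f := xchoose (codes_exists f).
have gP f : codes f (g f) by exact: xchooseP.
pose swap (p : 'I_n * 'I_n * 'I_n) := (p.1.1, p.2, p.1.2).
have swapK : involutive swap by case=> [[]].
have codes_swap f p : codes f (swap p) = codes f p.
  by case: p => [[x y] z]; rewrite /swap /= codes_sym.
have g_inj : injective g by move=> f f' e; apply: (codes_inj (gP f)); rewrite e.
have -> : triples S = [set g f | f in S] :|: [set swap (g f) | f in S].
  apply/setP=> p; rewrite in_setU; apply/triplesP/orP => [[f fS fp]|].
    have := gP f; case: p fp => [[x y] z] fp; case eg: (g f) => [[x' y'] z'] fp'.
    have [ex [[ey ez]|[ey ez]]] := codes_fun fp fp'; [left|right];
    by apply/imsetP; exists f; rewrite // eg /swap /= ex ey ez.
  by case=> /imsetP[f fS ->]; exists f; rewrite ?codes_swap.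
rewrite (_ : #|_ :|: _| = #|[set g f | f in S]| + #|[set swap (g f) | f in S]|).
  rewrite !card_imset //; first by rewrite mul2n addnn.
  by move=> f f' /(can_inj swapK)/g_inj.
apply/eqP; rewrite (leq_card_setU _ _).2; apply/pred0P=> p /=.
apply/negP=> /andP[/imsetP[f _ ->] /imsetP[f' _ e]].
have ff' : f = f' by apply: codes_inj (gP f) _; rewrite e codes_swap.
subst f'; have := gP f; case: (g f) e => [[x y] z] [eyz _] /codesP[_ _].
by rewrite eyz eqxx !andbF.
Qed.

(** Flags with codes (x, y, z) and (y, x, w) are adjacent as soon as w != z. *)
Lemma valid_triples S : independent adj S -> valid [set: 'I_n] (triples S).
Proof.
move=> indS; apply/validP; split=> [x y z|x y z|x y z|x y z w].
- by rewrite !in_setT.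
- by case/triplesP=> f _ /codesP[_ _ /and3P[]].
- by case/triplesP=> f fS fp; apply/triplesP; exists f; rewrite // codes_sym.
case/triplesP=> f fS fp /triplesP[g gS gp]; apply/eqP; apply: contraT => wz.
have := forall_inP (forall_inP indS f fS) g gS; rewrite (adjE fp gp).
have [_ _ /and3P[xy xz yz]] := codesP fp; have [_ _ /and3P[yx yw xw]] := codesP gp.
rewrite !inE !eqxx /= => /negP[]; apply/eqP/setP=> a; rewrite !inE.
apply/negP=> /andP[/orP[] /eqP-> /orP[] /eqP e]; subst;
  rewrite ?eqxx // in xy xz yz yx yw xw wz *.
Qed.

(** Adjacent flags have codes (x, x', y1) and (x', x, y2); validity makes y1 = y2 a common point of
    two disjoint pairs. *)
Lemma independent_triples S : valid [set: 'I_n] (triples S) -> independent adj S.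
Proof.
move=> vS; apply/forall_inP=> f fS; apply/forall_inP=> g gS.
have [[[x y] z] fp] := codes_exists f; have [[[x' y'] z'] gp] := codes_exists g.
rewrite (adjE fp gp); apply/negP=> /and3P[xin x'in /eqP dis].
have [y1 [fp1 e1]] : exists y1, codes f (x, x', y1) /\ y1 \in [set y; z].
  by move: x'in; rewrite !inE => /orP[] /eqP->; [exists z|exists y];
    rewrite !inE eqxx ?orbT // -codes_sym.
have [y2 [gp2 e2]] : exists y2, codes g (x', x, y2) /\ y2 \in [set y'; z'].
  by move: xin; rewrite !inE => /orP[] /eqP->; [exists z'|exists y'];
    rewrite !inE eqxx ?orbT // -codes_sym.
have : y2 = y1 by apply: (vind vS (x := x) (y := x'));
  rewrite ?(triplesE S fp1) ?(triplesE S gp2).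
by move=> e; have := in_set0 y1; rewrite -dis in_setI e1 -e e2.
Qed.

End Flags.

(** * Permutations of the ground set and the model families *)

Section Relabel.
Variable n : nat.
Hypothesis n5 : 4 < n.
Local Notation flagn := (flag n 1 (n - 2)).
Local Notation adj := (@Gamma_adj n 1 (n - 2)).
Implicit Types (f g : flagn) (x y z : 'I_n) (S : {set flagn}) (s : {perm 'I_n}).

Lemma relabel_flagP s f :
  [&& s @: f.1 \subset s @: f.2, #|s @: f.1| == 1 & #|s @: f.2| == n - 2].
Proof.
have /and3P[sub c1 c2] := flagP f.
by rewrite imsetS // !card_imset ?c1 ?c2 //; exact: perm_inj.
Qed.

Definition relabel_flag s f : flagn :=
  @Flag n 1 (n - 2) (s @: f.1, s @: f.2) (relabel_flagP s f).

Lemma relabel_flag_inj s : injective (relabel_flag s).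
Proof.
move=> f g [e1 e2]; apply: val_inj.
rewrite /= [val f]surjective_pairing [val g]surjective_pairing.
by congr pair; apply: (imset_inj (@perm_inj _ s)).
Qed.

Definition relabel s := perm (@relabel_flag_inj s).

Lemma general_position_relabel s (X Y : {set 'I_n}) :
  general_position (s @: X) (s @: Y) = general_position X Y.
Proof.
have sI := imset_inj (@perm_inj _ s).
have sT : s @: setT = setT.
  by apply/setP=> x; rewrite !inE -(permKV s x) imset_f // inE.
rewrite /general_position -imsetU -imsetI; last by move=> x y _ _; exact: perm_inj.
by rewrite -{1}sT (inj_eq sI) imset_eq0.
Qed.

Lemma relabel_aut s : relabel s \in graph_aut adj.
Proof.
rewrite inE; apply/forallP=> f; apply/forallP=> g.
by rewrite !permE /Gamma_adj /= !general_position_relabel.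
Qed.

Lemma codes_relabel s f x y z :
  codes f (x, y, z) -> codes (relabel s f) (s x, s y, s z).
Proof.
case/andP=> /eqP /= f1 /eqP f2; rewrite /codes permE /= f1 f2 imset_set1 eqxx /=.
apply/eqP/setP=> a; rewrite -(permKV s a) mem_imset; last exact: perm_inj.
by rewrite !inE !(inj_eq perm_inj).
Qed.

Lemma equivalent_relabel s S S' :
  (forall f, (f \in S) = (relabel s f \in S')) -> equivalent adj S S'.
Proof.
move=> e; apply/orbitP; exists (relabel s); first exact: relabel_aut.
apply/setP=> g; rewrite /= /setact /aperm -(permKV (relabel s) g).
by rewrite mem_imset ?e //; exact: perm_inj.
Qed.

Lemma cond_IIE i f x y z : codes f (x, y, z) ->
  cond_II i f = [&& x < i, x < y & x < z].
Proof.
case/codesP=> // f1 f2 _; apply/existsP/and3P => [[m]|[xi xy xz]].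
  case/and3P=> /andP[]; rewrite f1 inE => /eqP-> _ xi /subsetP sub.
  have out w : w \notin f.2 -> x < w.
    by apply: contraNltn => wx; apply: sub; rewrite inE ltnS.
  by split=> //; apply: out; rewrite f2 !inE eqxx ?orbT.
exists x; rewrite /is_min f1 inE eqxx xi /=; apply/andP; split.
  by apply/forall_inP=> w; rewrite inE => /eqP->.
apply/subsetP=> w; rewrite f2 !inE ltnS negb_or => wx.
by apply/andP; split; apply: contraTneq wx => ->; rewrite -ltnNge.
Qed.

Lemma initial_sub i f x y z : codes f (x, y, z) ->
  (initial n i \subset f.2) = (i <= y) && (i <= z).
Proof.
case/codesP=> // f1 f2 _; apply/subsetP/andP => [sub|[iy iz] w].
  have out w : w \notin f.2 -> i <= w.
    by apply: contraNleq => wi; apply: sub; rewrite inE.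
  by split; apply: out; rewrite f2 !inE eqxx ?orbT.
rewrite f2 !inE negb_or => wi.
by apply/andP; split; apply: contraTneq wi => ->; rewrite -leqNgt.
Qed.

Lemma sub_initial f x y z : codes f (x, y, z) ->
  (f.2 \subset initial n n.-1) = (val y == n.-1) || (val z == n.-1).
Proof.
case/codesP=> // f1 f2 _; have ltn1 : n.-1 < n by move: n5; clear; lia.
have -> : initial n n.-1 = ~: [set Ordinal ltn1].
  by apply/setP=> w; rewrite !inE -val_eqE /=; have := ltn_ord w; clear; lia.
by rewrite f2 setCS sub1set !inE -!val_eqE /= ![n.-1 == _]eq_sym.
Qed.

(** Condition (II) is the first clause of [ranked] and (I) the second, with the point n as
    centre. *)
Lemma F_setE j f x y z : j != 3 -> codes f (x, y, z) ->
  (f \in F_set n 1 (n - 2) (n - j)) = ranked j n x y z.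
Proof.
move=> /negbTE j3 fp; rewrite inE (cond_IIE _ fp) (initial_sub _ fp) (sub_initial fp).
by rewrite /ranked j3 /= orbC -!andbA.
Qed.

(** The index n - 3 is 2b - n + 1 for b = n - 2. *)
Lemma Fbar_setE f x y z : codes f (x, y, z) ->
  (f \in Fbar_set n 1 (n - 2) (n - 3)) = ranked 3 n x y z.
Proof.
move=> fp; rewrite inE (cond_IIE _ fp) (initial_sub _ fp).
by rewrite /ranked /= andbT orbC.
Qed.

Lemma codes_flag x y z : x != y -> x != z -> y != z -> exists f, codes f (x, y, z).
Proof.
move=> xy xz yz; have P : [&& [set x] \subset ~: [set y; z], #|[set x]| == 1
    & #|~: [set y; z]| == n - 2].
  by rewrite sub1set !inE negb_or xy xz cards1 eqxx cardsCs setCK card_ord cards2 yz /=.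
by exists (@Flag n 1 (n - 2) ([set x], ~: [set y; z]) P); rewrite /codes /= !eqxx.
Qed.

End Relabel.

(** * Independence number and classification *)

Lemma independence_number_Gamma n : 5 <= n ->
  independence_number (@Gamma_adj n 1 (n - 2)) = 'C(n, 3) + 2.
Proof.
move=> n5; have cT : #|[set: 'I_n]| = n by rewrite cardsT card_ord.
apply/eqP; rewrite eqn_leq; apply/andP; split.
  apply/bigmax_leqP => S /(valid_triples n5) vS.
  have := valid_le _ vS; rewrite cT card_triples // /bound leq_pmul2l //.
  by apply; rewrite (ltn_trans _ n5).
have en : n = (n - 3).+3 by move: n5; clear; lia.
have [S0 vS0 eS0] : exists2 S0, valid [set: 'I_n] S0 & #|S0| = bound n.
  by rewrite [in bound n]en; apply: extremal_exists; rewrite cT.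
(* The extremal system is pulled back to flags; [triples] recovers it because it is closed under
   swapping. *)
pose S := [set f : flag n 1 (n - 2) | [exists p in S0, codes f p]].
have eS : triples S = S0.
  apply/setP=> p; apply/triplesP/idP => [[f]|pS].
    rewrite inE => /exists_inP[[[x y] z] qS fq] fp; case: p fp => [[x' y'] z'] fp.
    by have [<- [[<- <-]|[<- <-]]] := codes_fun fq fp; last exact: (vsym vS0 qS).
  case: p pS => [[x y] z] pS; have [xy xz yz] := vneq vS0 pS.
  have [f fp] := codes_flag xy xz yz; exists f => //.
  by rewrite inE; apply/exists_inP; exists (x, y, z).
have indS : independent (@Gamma_adj n 1 (n - 2)) S.
  by apply: (independent_triples n5); rewrite eS.
suff <- : #|S| = 'C(n, 3) + 2 by apply: leq_bigmax_cond.
by apply/eqP; rewrite -(eqn_pmul2l (isT : 0 < 2)) -(card_triples n5) eS eS0.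
Qed.

Theorem mainTheorem11 (n : nat) (hn : 5 <= n) :
  independence_number (@Gamma_adj n 1 (n - 2)) = 'C(n, 3) + 2 /\
  (forall S : {set flag n 1 (n - 2)},
     independent (@Gamma_adj n 1 (n - 2)) S ->
     #|S| = 'C(n, 3) + 2 ->
     [\/ equivalent (@Gamma_adj n 1 (n - 2)) S (F_set n 1 (n - 2) (n - 5)),
         equivalent (@Gamma_adj n 1 (n - 2)) S (F_set n 1 (n - 2) (n - 4))
       | equivalent (@Gamma_adj n 1 (n - 2)) S (Fbar_set n 1 (n - 2) (n - 3))]).
Proof.
split=> [|S indS eS]; first exact: independence_number_Gamma.
have cT : #|[set: 'I_n]| = n by rewrite cardsT card_ord.
have vS := valid_triples hn indS.
have en : n = (n - 3).+3 by move: hn; clear; lia.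
have eT : #|triples S| = bound n by rewrite card_triples // eS.
have [l [j [ul lV j345 jn rk]]] : exists l (j : nat),
    [/\ uniq l, l =i [set: 'I_n], [|| j == 3, j == 4 | j == 5], j <= n &
    forall x y z, x != y -> x != z -> y != z ->
      ((x, y, z) \in triples S) = ranked j n (index x l) (index y l) (index z l)].
  have := extremal_order (n := n - 3) (V := [set: 'I_n]); rewrite -en => H.
  have [l [j [ul lV j345 jn rk]]] := H _ cT vS eT; exists l, j; split=> // x y z.
  by apply: rk; rewrite inE.
have sz : size l = n by rewrite -(card_uniqP ul) (eq_card lV).
have idx x : index x l < n by rewrite -[X in _ < X]sz index_mem lV inE.
(* Sending each point to its position in [l] permutes the ground set and carries [S] to a model. *)
have sinj : injective (fun x => Ordinal (idx x)).
  by move=> x y [] /(congr1 (nth x l)); rewrite !nth_index ?lV ?inE.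
pose s := perm sinj.
have mem f x y z : codes f (x, y, z) ->
    (f \in S) = ranked j n (s x) (s y) (s z).
  move=> fp; rewrite -(triplesE S fp); have [_ _ /and3P[xy xz yz]] := codesP hn fp.
  by rewrite rk // !permE.
case/or3P: j345 => /eqP ej; subst j; [constructor 3|constructor 2|constructor 1];
  apply: (equivalent_relabel (s := s)) => f; have [[[x y] z] fp] := codes_exists hn f;
  rewrite (mem f x y z fp).
- by rewrite (Fbar_setE hn (codes_relabel s fp)).
- by rewrite (F_setE hn _ (codes_relabel s fp)).
by rewrite (F_setE hn _ (codes_relabel s fp)).
Qed.
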